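(* Let $G$ be a 3-connected graph (not necessarily finite), $G'$ a graph that is not a circuit, and $f:G\rightarrow G'$ a circuit surjection. Then $f$ is induced by a vertex isomorphism, i.e. there is a bijection $\varphi:V(G)\to V(G')$ such that $f(uv)=\varphi(u)\varphi(v)$ for every edge $uv$ of $G$.
   Context: Graphs are undirected, without loops or multiple edges, possibly infinite. A circuit surjection $f:G\rightarrow G'$ is a map from $E(G)$ onto $E(G')$ such that for every circuit $C$ of $G$, $f(C)$ is a circuit of $G'$; $G'$ is required to have no isolated vertices. ''$G'$ is not a circuit'' means $G'$ is not itself a single cycle. *)

(* Defs.v *)
From Stdlib Require Import Arith List.

Record graph := Graph {
  vert :> Type;
  adj : vert -> vert -> Prop;
  adj_sym : forall u v, adj u v -> adj v u;
  adj_irrefl : forall v, ~ adj v v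
}.

Definition upair {V : Type} (u v : V) : V -> Prop := fun x => x = u \/ x = v.

Definition edge (G : graph) : Type :=
  { S : G -> Prop | exists u v : G, adj G u v /\ S = upair u v }.

Definition mk_edge (G : graph) (u v : G) (h : adj G u v) : edge G :=
  exist _ (upair u v) (ex_intro _ u (ex_intro _ v (conj h eq_refl))).

Definition circuit (G : graph) (C : edge G -> Prop) : Prop :=
  exists (n : nat) (c : nat -> G),
    3 <= n /\
    (forall i j, i < n -> j < n -> c i = c j -> i = j) /\
    (forall i, i < n -> adj G (c i) (c (S i mod n))) /\
    (forall e : edge G,
        C e <-> exists i, i < n /\ proj1_sig e = upair (c i) (c (S i mod n))).

Definition eimage {G G' : graph} (f : edge G -> edge G') (C : edge G -> Prop)
  : edge G' -> Prop := fun e' => exists e, C e /\ f e = e'.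

Definition circuit_surjection {G G' : graph} (f : edge G -> edge G') : Prop :=
  (forall e' : edge G', exists e, f e = e') /\
  (forall C, circuit G C -> circuit G' (eimage f C)).

Definition no_isolated (G : graph) : Prop := forall v : G, exists w, adj G v w.

Definition is_circuit_graph (G : graph) : Prop := circuit G (fun _ => True).

Definition path_avoiding (G : graph) (X : list G) (x y : G) : Prop :=
  exists (n : nat) (p : nat -> G),
    p 0 = x /\ p n = y /\
    (forall i, i <= n -> ~ In (p i) X) /\
    (forall i, i < n -> adj G (p i) (p (S i))).

(* k-connected (Diestel): more than k vertices and G - X connected for
   every vertex set X with |X| < k. *)
Definition k_connected (k : nat) (G : graph) : Prop :=
  (exists l : list G, NoDup l /\ k < length l) /\
  (forall X : list G, length X < k ->
     forall x y : G, ~ In x X -> ~ In y X -> path_avoiding G X x y).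

(* Main.v *)
Require Import Defs.
From Stdlib Require Import Arith List.
From Stdlib Require Import Lia Classical ClassicalEpsilon.
From Stdlib Require Import FunctionalExtensionality PropExtensionality ProofIrrelevance.
Import ListNotations.

(** Injectivity. Let the paths of a theta subgraph have images A1, A2, A3. The
    symmetric difference of the circuits A1 u A2 and A1 u A3 is even and lies in
    the circuit A2 u A3, so it is empty or all of A2 u A3; hence if some colour
    occurs in two of the Ai, all three circuits of the theta have the same image.
    If f e1 = f e2 for distinct edges, take a circuit C through both. By
    3-connectedness every ear of C lies in a circuit linked to C by such thetas,
    so f C contains every colour, and G' is a circuit.

    Stars. For injective f, the preimage S_w of the star of a vertex w of G' meets
    every circuit in 0 or 2 edges, so it is a bond. If two such bonds cross, with
    sides X1 and X2, then a circuit meeting both meets all four quadrants: from a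
    vertex b in a missed quadrant, two paths to the part of the circuit across
    S_1, disjoint except at b, would give a circuit with three edges of S_1, so one
    vertex separates b from that part, another does so for S_2, and together they
    contradict 3-connectedness. Consequently no edge is in both bonds, the
    quadrants are connected and arranged in a ring, and two vertices, in opposite
    quadrants, disconnect G: so no two bonds cross. If both sides of S_w contained
    an edge, a circuit through two such edges would have an image passing through
    some w' whose S_w' crosses S_w. Hence every S_w is the star of a vertex of G,
    which defines the isomorphism. *)

(** * Sets as predicates and unordered pairs *)

Lemma pred_ext (T : Type) (A B : T -> Prop) : (forall x, A x <-> B x) -> A = B.
Proof.
  intro H; apply functional_extensionality; intro x.
  apply propositional_extensionality, H.
Qed.

Definition cup {T : Type} (A B : T -> Prop) : T -> Prop := fun x => A x \/ B x.

Lemma upair_eq (V : Type) (a b c d : V) :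
  upair a b = upair c d -> (a = c /\ b = d) \/ (a = d /\ b = c).
Proof.
  intro H.
  assert (E : forall x, upair a b x <-> upair c d x) by (intro x; rewrite H; tauto).
  unfold upair in E.
  destruct (proj1 (E a) (or_introl eq_refl)), (proj1 (E b) (or_intror eq_refl));
    destruct (proj2 (E c) (or_introl eq_refl)), (proj2 (E d) (or_intror eq_refl));
    subst; auto.
Qed.

Lemma upair_sym (V : Type) (a b : V) : upair a b = upair b a.
Proof. apply pred_ext; unfold upair; tauto. Qed.

Definition joins {G : graph} (e : edge G) (x y : G) : Prop := proj1_sig e = upair x y.

(** * Edges, simple paths and reachability *)

Section Edges.
Context {G : graph}.
Implicit Types (x y u v : G) (e g : edge G).

Lemma edge_ext e g : proj1_sig e = proj1_sig g -> e = g.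
Proof.
  destruct e as [S p], g as [S' p']; simpl; intro H; subst.
  f_equal; apply proof_irrelevance.
Qed.

Lemma joins_sym e x y : joins e x y -> joins e y x.
Proof. unfold joins; intro H; rewrite H; apply upair_sym. Qed.

Lemma joins_unique e g x y : joins e x y -> joins g x y -> e = g.
Proof. unfold joins; intros; apply edge_ext; congruence. Qed.

Lemma joins_ends e x y u v :
  joins e x y -> joins e u v -> (x = u /\ y = v) \/ (x = v /\ y = u).
Proof. unfold joins; intros H K; apply upair_eq; congruence. Qed.

Lemma joins_exists e : exists x y, joins e x y.
Proof. destruct e as [S [u [v [h H]]]]; exists u, v; exact H. Qed.

Lemma joins_adj e x y : joins e x y -> adj G x y.
Proof.
  destruct e as [S [u [v [h H]]]]; unfold joins; simpl; intro K.
  rewrite H in K; destruct (upair_eq _ _ _ _ _ K) as [[? ?]|[? ?]]; subst; auto.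
  apply adj_sym; auto.
Qed.

Lemma adj_joins x y : adj G x y -> exists e, joins e x y.
Proof. intro h; exists (mk_edge G x y h); reflexivity. Qed.

Lemma joins_neq e x y : joins e x y -> x <> y.
Proof. intros H E; subst; apply joins_adj in H; exact (adj_irrefl _ _ H). Qed.

Lemma joins_in e x y v : joins e x y -> (proj1_sig e v <-> v = x \/ v = y).
Proof. unfold joins; intro H; rewrite H; unfold upair; tauto. Qed.

Lemma in_joins e x : proj1_sig e x -> exists y, joins e x y.
Proof.
  intro H; destruct (joins_exists e) as [u [v K]].
  destruct (proj1 (joins_in _ _ _ _ K) H); subst; eauto using joins_sym.
Qed.

Lemma edge_eq_of_ends e g s t :
  (forall v, proj1_sig e v -> v = s \/ v = t) ->
  (forall v, proj1_sig g v -> v = s \/ v = t) -> e = g.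
Proof.
  assert (A : forall e, (forall v, proj1_sig e v -> v = s \/ v = t) -> joins e s t).
  { intros e' H; destruct (joins_exists e') as [x [y K]].
    assert (N := joins_neq _ _ _ K).
    assert (X := H x (proj2 (joins_in _ _ _ _ K) (or_introl eq_refl))).
    assert (Y := H y (proj2 (joins_in _ _ _ _ K) (or_intror eq_refl))).
    destruct X, Y; subst; try congruence; auto using joins_sym. }
  intros H K; eapply joins_unique; eauto.
Qed.

(** The vertex set and the edge set are indices, so that joining and splitting paths become unions
    of predicates. The condition [~ V x] makes paths simple; the length serves inductions and the
    bound in [circuit_close]. *)
Inductive pathn : nat -> G -> G -> (G -> Prop) -> (edge G -> Prop) -> Prop :=
| pathn_nil x : pathn 0 x x (eq x) (fun _ => False)
| pathn_cons n x y z V E e :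
    joins e x y -> pathn n y z V E -> ~ V x ->
    pathn (S n) x z (cup (eq x) V) (cup (eq e) E).

Definition path x y V E := exists n, pathn n x y V E.

Lemma path_nil x : path x x (eq x) (fun _ => False).
Proof. exists 0; constructor. Qed.

Lemma path_cons x y z V E e :
  joins e x y -> path y z V E -> ~ V x -> path x z (cup (eq x) V) (cup (eq e) E).
Proof. intros H [n K] N; exists (S n); econstructor; eauto. Qed.

Lemma path_ind' (P : G -> G -> (G -> Prop) -> (edge G -> Prop) -> Prop) :
  (forall x, P x x (eq x) (fun _ => False)) ->
  (forall x y z V E e, joins e x y -> path y z V E -> P y z V E -> ~ V x ->
     P x z (cup (eq x) V) (cup (eq e) E)) ->
  forall x y V E, path x y V E -> P x y V E.
Proof.
  intros H0 H1 x y V E [n H]; induction H; auto.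
  eapply H1; eauto. exists n; auto.
Qed.

Lemma path_start x y V E : path x y V E -> V x.
Proof. intros [n H]; destruct H; unfold cup; auto. Qed.

Lemma path_end x y V E : path x y V E -> V y.
Proof. intros [n H]; induction H; unfold cup; auto. Qed.

Lemma path_edge x y V E e v : path x y V E -> E e -> proj1_sig e v -> V v.
Proof.
  intro H; revert e v; induction H using path_ind'; [tauto|].
  intros e' v [->|He] Hv; [|right; eauto].
  destruct (proj1 (joins_in _ _ _ _ H) Hv); subst; [left; auto|].
  right; eapply path_start; eauto.
Qed.

Lemma path_app x y z V1 E1 V2 E2 :
  path x y V1 E1 -> path y z V2 E2 -> (forall v, V1 v -> V2 v -> v = y) ->
  path x z (cup V1 V2) (cup E1 E2).
Proof.
  intro H; revert z V2 E2; induction H using path_ind'; intros z' V2 E2 K D.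
  - replace (cup (eq x) V2) with V2; [replace (cup (fun _ => False) E2) with E2; auto|].
    + apply pred_ext; unfold cup; tauto.
    + apply pred_ext; intro v; unfold cup; split; [tauto|].
      intros [->|]; auto. eapply path_start; eauto.
  - assert (N : ~ cup V V2 x).
    { intros [|F]; [tauto|]. apply H1.
      rewrite (D x (or_introl eq_refl) F). eapply path_end; eauto. }
    assert (P := path_cons _ _ _ _ _ _ H (IHpath _ _ _ K (fun v a b => D v (or_intror a) b)) N).
    replace (cup (cup (eq x) V) V2) with (cup (eq x) (cup V V2))
      by (apply pred_ext; unfold cup; tauto).
    replace (cup (cup (eq e) E) E2) with (cup (eq e) (cup E E2))
      by (apply pred_ext; unfold cup; tauto).
    exact P.
Qed.

Lemma path_single e x y : joins e x y -> path x y (upair x y) (eq e).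
Proof.
  intro H.
  replace (upair x y) with (cup (eq x) (eq y))
    by (apply pred_ext; unfold cup, upair; intuition congruence).
  replace (eq e) with (cup (eq e) (fun _ => False))
    by (apply pred_ext; unfold cup; tauto).
  eapply path_cons; eauto using path_nil.
  intro E; subst; eapply joins_neq; eauto.
Qed.

Lemma path_rev x y V E : path x y V E -> path y x V E.
Proof.
  intro H; induction H using path_ind'; [apply path_nil|].
  assert (P := path_app _ _ _ _ _ _ _ IHpath (path_single _ _ _ (joins_sym _ _ _ H))).
  replace (cup (eq x) V) with (cup V (upair y x)).
  - replace (cup (eq e) E) with (cup E (eq e)) by (apply pred_ext; unfold cup; tauto).
    apply P. intros v A [B|B]; subst; tauto.
  - apply pred_ext; intro v; unfold cup, upair; split; [|intuition].
    intros [Hv|[Hv|Hv]]; subst; auto. right; eapply path_start; eauto.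
Qed.

Lemma pathn_split n x y V E v :
  pathn n x y V E -> V v -> exists n1 n2 V1 E1 V2 E2,
    pathn n1 x v V1 E1 /\ pathn n2 v y V2 E2 /\ n = n1 + n2 /\
    V = cup V1 V2 /\ E = cup E1 E2 /\ (forall w, V1 w -> V2 w -> w = v).
Proof.
  intro H; revert v; induction H as [x|n x y z V E e H K IH N]; intros v Hv.
  - subst v; exists 0, 0, (eq x), (fun _ => False), (eq x), (fun _ => False).
    repeat split; try constructor; auto; apply pred_ext; unfold cup; tauto.
  - destruct Hv as [<-|Hv].
    + exists 0, (S n), (eq x), (fun _ => False), (cup (eq x) V), (cup (eq e) E).
      repeat split; try (econstructor; eauto; fail); auto;
        apply pred_ext; unfold cup; tauto.
    + destruct (IH v Hv) as (n1 & n2 & V1 & E1 & V2 & E2 & A & B & C & D & F & I).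
      exists (S n1), n2, (cup (eq x) V1), (cup (eq e) E1), V2, E2.
      subst; repeat split; auto.
      * econstructor; eauto. unfold cup in N; tauto.
      * apply pred_ext; unfold cup; tauto.
      * apply pred_ext; unfold cup; tauto.
      * intros w [<-|a] b; [exfalso; apply N; right; auto|auto].
Qed.

Lemma path_split x y V E v :
  path x y V E -> V v -> exists V1 E1 V2 E2,
    path x v V1 E1 /\ path v y V2 E2 /\
    V = cup V1 V2 /\ E = cup E1 E2 /\ (forall w, V1 w -> V2 w -> w = v).
Proof.
  intros [n H] Hv; destruct (pathn_split _ _ _ _ _ _ H Hv)
    as (n1 & n2 & V1 & E1 & V2 & E2 & A & B & C & D & F & I).
  exists V1, E1, V2, E2; unfold path; eauto 10.
Qed.

(** An edge has two distinct ends, so a common edge would give two common vertices. *)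
Lemma path_edges_disjoint x y V1 E1 x' y' V2 E2 s e :
  path x y V1 E1 -> path x' y' V2 E2 -> (forall w, V1 w -> V2 w -> w = s) ->
  E1 e -> E2 e -> False.
Proof.
  intros H K D A B; destruct (joins_exists e) as [u [v J]].
  assert (F : forall w, proj1_sig e w -> w = s)
    by (intros w Hw; apply D; eapply path_edge; eauto).
  apply (joins_neq _ _ _ J).
  rewrite (F u), (F v); auto; apply (joins_in _ _ _ _ J); auto.
Qed.

(** Truncation at the first vertex of [W]; applied to make a path touch a given subgraph only at its
    end. *)
Lemma path_first x y V E (W : G -> Prop) :
  path x y V E -> (exists w, V w /\ W w) -> exists z V' E',
    path x z V' E' /\ W z /\ (forall v, V' v -> W v -> v = z) /\
    (forall v, V' v -> V v) /\ (forall e, E' e -> E e).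
Proof.
  intro H; induction H using path_ind'; intros [w [Vw Ww]].
  - subst w; exists x, (eq x), (fun _ => False); repeat split; auto using path_nil.
  - destruct (classic (W x)) as [Wx|Wx].
    + exists x, (eq x), (fun _ => False); unfold cup; repeat split; auto using path_nil; tauto.
    + destruct IHpath as (z' & V' & E' & A & B & C & D & F).
      { destruct Vw as [->|]; [tauto|eauto]. }
      exists z', (cup (eq x) V'), (cup (eq e) E'); unfold cup; repeat split; auto.
      * eapply path_cons; eauto.
      * intros v [->|]; [tauto|auto].
      * intros v [->|]; auto.
      * intros v [->|]; auto.
Qed.

Lemma path_crossing x y V E (X : G -> Prop) :
  path x y V E -> X x -> ~ X y -> exists e u v, E e /\ joins e u v /\ X u /\ ~ X v.
Proof.
  intro H; induction H using path_ind'; intros A B; [tauto|].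
  destruct (classic (X y)) as [C|C].
  - destruct IHpath as (g & u & v & K & L); auto.
    exists g, u, v; unfold cup; tauto.
  - exists e, x, y; unfold cup; auto.
Qed.

Definition conn (K : G -> Prop) (F : edge G -> Prop) x y :=
  exists V E, path x y V E /\ (forall v, V v -> K v) /\ (forall e, E e -> F e).

Lemma conn_refl K F x : K x -> conn K F x x.
Proof. intro H; exists (eq x), (fun _ => False); repeat split; auto using path_nil.
  intros v <-; auto. tauto. Qed.

Lemma conn_sym K F x y : conn K F x y -> conn K F y x.
Proof. intros (V & E & A & B & C); exists V, E; auto using path_rev. Qed.

(** Since [conn] is witnessed by a simple path, an [x] already on that path calls for a shortcut:
    the tail from [x] replaces the extension. *)
Lemma conn_step K F e x y z : joins e x y -> K x -> F e -> conn K F y z -> conn K F x z.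
Proof.
  intros J Kx Fe (V & E & A & B & C).
  destruct (classic (V x)) as [Hx|Hx].
  - destruct (path_split _ _ _ _ _ A Hx) as (V1 & E1 & V2 & E2 & P & Q & -> & -> & _).
    exists V2, E2; unfold cup in *; repeat split; auto.
  - exists (cup (eq x) V), (cup (eq e) E); repeat split; eauto using path_cons.
    + intros v [<-|]; auto.
    + intros v [<-|]; auto.
Qed.

Lemma conn_trans K F x y z : conn K F x y -> conn K F y z -> conn K F x z.
Proof.
  intros (V & E & A & B & C); revert B C.
  induction A using path_ind'; intros B C D; auto.
  apply (conn_step _ _ e _ y); unfold cup in *; auto.
Qed.

Lemma conn_mono (K K' : G -> Prop) (F F' : edge G -> Prop) x y :
  (forall v, K v -> K' v) -> (forall e, F e -> F' e) -> conn K F x y -> conn K' F' x y.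
Proof. intros A B (V & E & C & D & H); exists V, E; auto. Qed.

Lemma conn_edge K (F : edge G -> Prop) e x y :
  joins e x y -> K x -> K y -> F e -> conn K F x y.
Proof. intros; eapply conn_step; eauto using conn_refl. Qed.

End Edges.

Section Circuits.
Context {G : graph}.
Implicit Types (x y u v s t : G) (e g h : edge G).

(** Passage from inductive paths to the indexed sequences used by [circuit]. *)
Lemma pathn_fun n x y V E :
  @pathn G n x y V E -> exists p : nat -> G,
    p 0 = x /\ p n = y /\
    (forall i j, i <= n -> j <= n -> p i = p j -> i = j) /\
    (forall i, i <= n -> V (p i)) /\
    (forall i, i < n -> adj G (p i) (p (S i))) /\
    (forall e, E e <-> exists i, i < n /\ joins e (p i) (p (S i))).
Proof.
  intro H; induction H as [x|n x y z V E e H K IH N].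
  - exists (fun _ => x); repeat split; auto; try lia.
    intros [i [F _]]; lia.
  - destruct IH as (p & P0 & Pn & I & W & A & C).
    exists (fun i => match i with 0 => x | S j => p j end); repeat split; auto.
    + intros [|i] [|j] Hi Hj F; auto.
      * exfalso; apply N; rewrite F; apply W; lia.
      * exfalso; apply N; rewrite <- F; apply W; lia.
      * f_equal; apply I; auto; lia.
    + intros [|i] Hi; [left; auto|right; apply W; lia].
    + intros [|i] Hi; [rewrite P0; eapply joins_adj; eauto|apply A; lia].
    + intros [<-|F].
      * exists 0; split; [lia|rewrite P0; auto].
      * destruct (proj1 (C e0) F) as [i [Hi J]]; exists (S i); split; [lia|auto].
    + intros [[|i] [Hi J]].
      * left; eapply joins_unique; eauto. rewrite P0 in J; auto.
      * right; apply C; exists i; split; [lia|auto].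
Qed.

(** The [n + 1] vertices of the path, at least three, form the cyclic sequence; the closing edge has
    index [n], where the successor wraps around to 0. *)
Lemma circuit_close n x y V E e :
  pathn n x y V E -> 2 <= n -> joins e y x -> circuit G (cup (eq e) E).
Proof.
  intros H L J; destruct (pathn_fun _ _ _ _ _ H) as (p & P0 & Pn & I & W & A & C).
  assert (M : forall i, i < n -> S i mod S n = S i) by (intros; apply Nat.mod_small; lia).
  assert (Z : S n mod S n = 0) by (apply Nat.Div0.mod_same).
  exists (S n), p; split; [lia|split; [|split]].
  - intros; apply I; auto; lia.
  - intros i Hi; destruct (Nat.eq_dec i n) as [->|].
    + rewrite Z, P0, Pn; eapply joins_adj; eauto.
    + rewrite M by lia; apply A; lia.
  - intro e'; split.
    + intros [<-|F].
      * exists n; split; [lia|rewrite Z, P0, Pn; exact J].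
      * destruct (proj1 (C e') F) as [i [Hi K]]; exists i; split; [lia|rewrite M; auto].
    + intros [i [Hi K]]; destruct (Nat.eq_dec i n) as [->|].
      * left; rewrite Z, P0, Pn in K; eapply joins_unique; eauto.
      * right; apply C; exists i; split; [lia|rewrite M in K by lia; exact K].
Qed.

(** The first edge [e] of the first path is set aside; the second path followed by the rest of the
    first one backwards is a simple path that [e] closes. The last hypothesis excludes two copies of
    one edge. *)
Lemma circuit_of_paths s t V1 E1 V2 E2 :
  path s t V1 E1 -> path s t V2 E2 -> s <> t ->
  (forall v, V1 v -> V2 v -> v = s \/ v = t) ->
  (exists e, (E1 e /\ ~ E2 e) \/ (E2 e /\ ~ E1 e)) ->
  circuit G (cup E1 E2).
Proof.
  intros H1 H2 N D Hd.
  destruct H1 as [n H1]; destruct H1 as [s|n s y t V1 E1 e J H1 Ns]; [tauto|].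
  assert (H1' : path y t V1 E1) by (exists n; auto).
  assert (P : path s y (cup V2 V1) (cup E2 E1)).
  { eapply path_app; [apply H2|apply path_rev; eauto|].
    intros v a b; destruct (D v (or_intror b) a); subst; tauto. }
  assert (Ne : ~ E1 e).
  { intro F; apply Ns; eapply path_edge; eauto. apply (joins_in _ _ _ _ J); auto. }
  replace (cup (cup (eq e) E1) E2) with (cup (eq e) (cup E2 E1))
    by (apply pred_ext; unfold cup; tauto).
  destruct P as [m P]; apply (circuit_close m s y (cup V2 V1)); auto using joins_sym.
  (* Length 0 would make [e] a loop. Length 1 would make the path the edge [e] itself, so that both
     given paths have edge set [e] alone. *)
  destruct m as [|[|m]]; [| |lia]; exfalso.
  - inversion P; subst. eapply joins_neq; eauto.
  - inversion P as [|n' x' y' z' V' E' g Jg Pg Ng Q1 Q2 Q3 QV QE]; subst.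
    inversion Pg; subst.
    assert (g = e) by (eapply joins_unique; eauto); subst g.
    assert (Q : forall h, cup (eq e) (fun _ => False) h <-> cup E2 E1 h)
      by (intro h; rewrite QE; tauto).
    unfold cup in Q.
    assert (E2 e) by (destruct (proj1 (Q e)); tauto).
    destruct Hd as [h Hh]; unfold cup in Hh; specialize (proj2 (Q h)); intro.
    destruct Hh as [[[<-|?] ?]|[? ?]]; try tauto.
    all: assert (e = h) by tauto; subst; tauto.
Qed.

(** With [w = c l] and [k] the cyclic predecessor of [l], the edges at [w] are those of index [k]
    and [l]; they differ because the circuit has at least three vertices. *)
Lemma circuit_edges_at D w e :
  circuit G D -> D e -> proj1_sig e w -> exists g h, g <> h /\ D g /\ D h /\
    (forall k, D k -> (proj1_sig k w <-> k = g \/ k = h)).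
Proof.
  intros (n & c & L & I & A & C) De Hw.
  assert (S1 : forall i, i < n -> S i mod n < n) by (intros; apply Nat.mod_upper_bound; lia).
  assert (Inj : forall i j, i < n -> j < n -> S i mod n = S j mod n -> i = j).
  { intros i j Hi Hj; destruct (Nat.eq_dec (S i) n) as [E1|], (Nat.eq_dec (S j) n) as [E2|];
    try (rewrite E1, Nat.Div0.mod_same); try (rewrite E2, Nat.Div0.mod_same);
    rewrite ?(Nat.mod_small (S i)), ?(Nat.mod_small (S j)) by lia; lia. }
  assert (Neq : forall i, i < n -> i <> S i mod n).
  { intros i Hi; destruct (Nat.eq_dec (S i) n) as [E1|];
    [rewrite E1, Nat.Div0.mod_same|rewrite Nat.mod_small]; lia. }
  assert (K : exists k, k < n /\ w = c (S k mod n)).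
  { destruct (proj1 (C e) De) as [i [Hi J]].
    destruct (proj1 (joins_in _ _ _ _ J) Hw); [|eauto].
    destruct i as [|i].
    - exists (n - 1); split; [lia|]; replace (S (n - 1)) with n by lia.
      rewrite Nat.Div0.mod_same; auto.
    - exists i; split; [lia|]; rewrite Nat.mod_small; auto. }
  destruct K as [k [Hk Hwk]]; set (l := S k mod n) in *.
  assert (Hl : l < n) by (apply S1; auto).
  destruct (adj_joins _ _ (A k Hk)) as [g Jg], (adj_joins _ _ (A l Hl)) as [h Jh].
  assert (Kl : k <> l) by (apply Neq; auto).
  exists g, h; split; [|split; [|split]].
  - intro F; subst h; destruct (joins_ends _ _ _ _ _ Jg Jh) as [[X _]|[X Y]].
    + apply I in X; auto.
    + apply I in X; auto. unfold l in X.
      destruct (Nat.eq_dec (S k) n) as [E1|NE].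
      { rewrite E1, Nat.Div0.mod_same in X; rewrite Nat.mod_small in X by lia; lia. }
      rewrite (Nat.mod_small (S k)) in X by lia.
      destruct (Nat.eq_dec (S (S k)) n) as [E2|];
        [rewrite E2, Nat.Div0.mod_same in X|rewrite Nat.mod_small in X by lia]; lia.
  - apply C; eauto.
  - apply C; eauto.
  - intros f Df; split.
    + intro Hf; destruct (proj1 (C f) Df) as [i [Hi J]].
      destruct (proj1 (joins_in _ _ _ _ J) Hf) as [X|X].
      * right; eapply joins_unique; eauto. subst w; apply I in X; auto. rewrite <- X; auto.
      * left; subst w; apply I in X; auto. apply Inj in X; auto; subst.
        eapply joins_unique; eauto.
    + intros [->| ->]; [apply (joins_in _ _ _ _ Jg)|apply (joins_in _ _ _ _ Jh)]; auto.
Qed.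

Lemma interval_iff (tau : nat -> Prop) a b :
  a <= b -> (forall k, a < k <= b -> (tau (k - 1) <-> tau k)) -> (tau a <-> tau b).
Proof.
  induction 1 as [|b L IH]; intro H; [tauto|].
  rewrite IH by (intros; apply H; lia).
  rewrite <- (H (S b)) by lia. replace (S b - 1) with b by lia; tauto.
Qed.

(** Deleting at most one vertex keeps the other edges of a circuit consecutive, so a property that
    passes between neighbouring edges is constant on them. Symmetric differences need no deletion;
    [pulled_star_one_sided] deletes [w]. *)
Lemma circuit_propagate D (T : edge G -> Prop) (ok : G -> Prop) :
  circuit G D ->
  (forall u v, ~ ok u -> ~ ok v -> u = v) ->
  (forall g h w, D g -> D h -> g <> h -> proj1_sig g w -> proj1_sig h w ->
     (forall u, proj1_sig g u -> ok u) -> (forall u, proj1_sig h u -> ok u) ->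
     (T g <-> T h)) ->
  forall g h, D g -> D h -> (forall w, proj1_sig g w -> ok w) ->
    (forall w, proj1_sig h w -> ok w) -> (T g <-> T h).
Proof.
  intros (n & c & L & I & A & C) One HT.
  set (tau := fun i => exists e, joins e (c i) (c (S i mod n)) /\ T e).
  assert (Tau : forall i e, joins e (c i) (c (S i mod n)) -> (T e <-> tau i)).
  { intros i e J; split; [intro; exists e; auto|].
    intros [e' [J' H]]; rewrite (joins_unique _ _ _ _ J J'); auto. }
  assert (Step : forall i j, i < n -> j < n -> S i mod n = j ->
            ok (c i) -> ok (c j) -> ok (c (S j mod n)) -> (tau i <-> tau j)).
  { intros i j Hi Hj Hij Oi Oj Oj'.
    destruct (adj_joins _ _ (A i Hi)) as [g Jg], (adj_joins _ _ (A j Hj)) as [h Jh].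
    rewrite <- (Tau _ _ Jg), <- (Tau _ _ Jh).
    destruct (classic (g = h)) as [->|N]; [tauto|].
    apply (HT g h (c j)); auto.
    - apply C; eauto.
    - apply C; eauto.
    - apply (joins_in _ _ _ _ Jg); right; congruence.
    - apply (joins_in _ _ _ _ Jh); auto.
    - intros u Hu; destruct (proj1 (joins_in _ _ _ _ Jg) Hu); subst; auto.
    - intros u Hu; destruct (proj1 (joins_in _ _ _ _ Jh) Hu); subst; auto. }
  assert (Succ : forall i, S i < n -> S i mod n = S i) by (intros; apply Nat.mod_small; lia).
  assert (Step' : forall k, 0 < k < n -> ok (c (k - 1)) -> ok (c k) -> ok (c (S k mod n)) ->
            (tau (k - 1) <-> tau k)).
  { intros k Hk; apply Step; try lia. replace (S (k - 1)) with k by lia.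
    apply Nat.mod_small; lia. }
  assert (Top : S (n - 1) mod n = 0)
    by (replace (S (n - 1)) with n by lia; apply Nat.Div0.mod_same).
  assert (Main : forall i j, i <= j -> j < n -> ok (c i) -> ok (c (S i mod n)) ->
            ok (c j) -> ok (c (S j mod n)) -> (tau i <-> tau j)).
  { intros i j Lij Hj Oi Oi' Oj Oj'.
    (* If the bad vertex lies between the two edges, the way round is the other one: from [i] down
       to 0, across the wrap, and from [n - 1] down to [j]. *)
    destruct (classic (exists k, i < k <= j /\ ~ ok (c k))) as [[k [Hk Bad]]|None].
    - assert (Ok : forall m, m < n -> m <> k -> ok (c m)).
      { intros m Hm Nm; apply NNPP; intro F; apply Nm; apply I; try lia; auto. }
      assert (Nj : k <> j) by (intros ->; auto).
      assert (Ni : k <> S i) by (intros ->; rewrite Succ in Oi' by lia; auto).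
      rewrite <- (interval_iff tau 0 i).
      2: lia.
      2:{ intros m Hm; apply Step'; try (apply Ok; lia); try lia.
          rewrite Succ by lia; apply Ok; lia. }
      rewrite (interval_iff tau j (n - 1)).
      2: lia.
      2:{ intros m Hm; apply Step'; try (apply Ok; lia); try lia.
          destruct (Nat.eq_dec m (n - 1)) as [->|]; [rewrite Top|rewrite Succ by lia];
            apply Ok; lia. }
      symmetry; apply Step; try lia; auto; try (apply Ok; lia).
      rewrite Succ by lia; apply Ok; lia.
    - assert (Ok : forall m, i <= m <= j -> ok (c m)).
      { intros m Hm; destruct (Nat.eq_dec m i) as [->|]; auto.
        apply NNPP; intro F; apply None; exists m; split; auto; lia. }
      apply interval_iff; auto. intros m Hm; apply Step'; try lia; try (apply Ok; lia).
      destruct (Nat.eq_dec m j) as [->|]; auto; rewrite Succ by lia; apply Ok; lia. }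
  intros g h Dg Dh Og Oh.
  destruct (proj1 (C g) Dg) as [i [Hi Ji]], (proj1 (C h) Dh) as [j [Hj Jj]].
  rewrite (Tau _ _ Ji), (Tau _ _ Jj).
  assert (ok (c i)) by (apply Og, (joins_in _ _ _ _ Ji); auto).
  assert (ok (c j)) by (apply Oh, (joins_in _ _ _ _ Jj); auto).
  assert (ok (c (S i mod n))) by (apply Og, (joins_in _ _ _ _ Ji); auto).
  assert (ok (c (S j mod n))) by (apply Oh, (joins_in _ _ _ _ Jj); auto).
  destruct (Nat.le_ge_cases i j); [|symmetry]; apply Main; auto.
Qed.

(** The symmetric difference has even degree everywhere and lies in [D3], so at each vertex of [D3]
    it contains both edges of [D3] or neither. Hence it is all of [D3] or empty, and [e0] excludes
    the former. *)
Lemma circuit_symdiff D1 D2 D3 :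
  circuit G D1 -> circuit G D2 -> circuit G D3 ->
  (forall e, D1 e -> ~ D2 e -> D3 e) -> (forall e, D2 e -> ~ D1 e -> D3 e) ->
  (exists e, D1 e /\ D2 e /\ D3 e) -> D1 = D2.
Proof.
  intros C1 C2 C3 S12 S21 [e0 [e1 [e2 e3]]].
  set (T := fun e => D1 e /\ ~ D2 e \/ D2 e /\ ~ D1 e).
  (* Parity at [w], starting from [g] in [D] but not in [D']. The other edge [k] of [D] at [w] is
     [h] unless it lies in [D']; then the other edge [l] of [D'] at [w] is not in [D], and it is
     [h]. *)
  assert (Half : forall D D', circuit G D -> circuit G D' ->
    (forall e, D e -> ~ D' e -> D3 e) -> (forall e, D' e -> ~ D e -> D3 e) ->
    forall g h w, D3 g -> D3 h -> g <> h -> proj1_sig g w -> proj1_sig h w ->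
    D g -> ~ D' g -> (D h /\ ~ D' h \/ D' h /\ ~ D h)).
  { intros D D' C C' S S' g h w Dg Dh N Hg Hh Ig Ng.
    destruct (circuit_edges_at _ _ _ C3 Dg Hg) as (a & b & Nab & Da & Db & K3).
    destruct (circuit_edges_at _ _ _ C Ig Hg) as (a' & b' & Nab' & Da' & Db' & K).
    assert (X : forall k, D3 k -> proj1_sig k w -> k <> g -> k = h).
    { intros k Dk Hk Nk; apply K3 in Hk, Hg, Hh; auto.
      intuition congruence. }
    assert (Y : exists k, D k /\ proj1_sig k w /\ k <> g).
    { destruct (classic (a' = g)) as [<-|]; [exists b'|exists a'];
        repeat split; auto; apply K; auto. }
    destruct Y as [k [Dk [Hk Nk]]].
    destruct (classic (D' k)) as [D'k|D'k].
    - destruct (circuit_edges_at _ _ _ C' D'k Hk) as (a'' & b'' & Nab'' & Da'' & Db'' & K').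
      assert (Y : exists l, D' l /\ proj1_sig l w /\ l <> k).
      { destruct (classic (a'' = k)) as [<-|]; [exists b''|exists a''];
          repeat split; auto; apply K'; auto. }
      destruct Y as [l [Dl [Hl Nl]]].
      assert (~ D l).
      { intro F; apply K in Hg, Hk; auto; apply K in Hl; auto.
        assert (l <> g) by congruence. intuition congruence. }
      assert (l = h) by (apply X; auto; congruence). subst; auto.
    - assert (k = h) by (apply X; auto). subst; auto. }
  assert (P : forall g h, D3 g -> D3 h -> (T g <-> T h)).
  { intros; apply (circuit_propagate D3 T (fun _ => True)); auto; try tauto.
    assert (Q : forall g h w, D3 g -> D3 h -> g <> h -> proj1_sig g w -> proj1_sig h w ->
              T g -> T h).
    { intros a b w Da Db N Ha Hb [[? ?]|[? ?]]; unfold T.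
      - apply (Half D1 D2 C1 C2 S12 S21 a b w); auto.
      - rewrite or_comm; apply (Half D2 D1 C2 C1 S21 S12 a b w); auto. }
    intros; split; eauto. }
  apply pred_ext; intro e.
  destruct (classic (D1 e)), (classic (D2 e)); try tauto; exfalso;
    assert (T e0) by (apply (P e e0); unfold T; auto); unfold T in *; tauto.
Qed.

End Circuits.

(* [sets] decides goals about membership in unions of vertex sets by forward
   chaining on the hypotheses of the form [forall v, _ -> ... -> _]. *)
Ltac known :=
  first [assumption | reflexivity | left; known | right; known | split; known].

Ltac strip H :=
  lazymatch type of H with
  | ?A -> ?B => let a := fresh in assert (a : A) by known; specialize (H a); clear a; strip H
  | _ => idtac
  end.

Ltac simplify_hyps :=
  repeat match goal with
  | H : _ /\ _ |- _ => destruct H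
  | H : ?a = ?a |- _ => clear H
  | H : ?a = ?b |- _ => subst a
  | H : ?a = ?b |- _ => subst b
  end; try contradiction.

Ltac redundant H :=
  let T := type of H in assert_succeeds (clear H; assert T by known).

Ltac forward_step :=
  match goal with
  | v : vert _, H : forall u : vert _, _ -> _ |- _ =>
      let N := fresh in
      pose proof (H v) as N; cbv beta in N; strip N;
      lazymatch type of N with
      | False => contradiction
      | ?T => lazymatch T with _ -> _ => fail | _ => assert_fails (redundant N) end
      end
  end.

Ltac split_step :=
  match goal with
  | H : cup _ _ _ |- _ => tryif redundant H then clear H else destruct H
  | H : _ \/ _ |- _ => tryif redundant H then clear H else destruct H
  end.

Ltac sets :=
  intros; lazymatch goal with |- ~ _ => intro | _ => idtac end;
  simplify_hyps; try known;
  repeat (first [forward_step | split_step]; simplify_hyps; try known).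

Ltac path_ends :=
  repeat match goal with
  | H : path ?x ?y ?V ?E |- _ =>
      lazymatch goal with
      | _ : V x |- _ => fail
      | _ => pose proof (path_start _ _ _ _ H)
      end
  | H : path ?x ?y ?V ?E |- _ =>
      lazymatch goal with
      | _ : V y |- _ => fail
      | _ => pose proof (path_end _ _ _ _ H)
      end
  end.

(** * Menger's theorem for two paths, and cycles with their vertex sets *)

Section Menger.
Context {G : graph}.
Implicit Types (x y z u v a b s t : G) (e g h : edge G) (A B K : G -> Prop).

Definition all_edges : edge G -> Prop := fun _ => True.

(* Goering's augmentation argument for Menger's theorem: a walk avoiding the
   end of the given path meets that path for the last time in some [v]; recurse
   on the initial segment up to [v], adding both tails from [v] to the target. *)
Lemma two_paths_extend K A n : forall B a x V E,
  pathn n a x V E -> A a -> B x -> (forall v, V v -> K v) ->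
  (forall v, V v -> B v -> v = x) ->
  (forall z, exists a b, A a /\ B b /\ conn (fun v => K v /\ v <> z) all_edges a b) ->
  exists a1 a2 y V1 E1 V2 E2,
    A a1 /\ A a2 /\ B y /\ path a1 x V1 E1 /\ path a2 y V2 E2 /\
    (forall v, V1 v -> K v) /\ (forall v, V2 v -> K v) /\
    (forall v, V1 v -> B v -> v = x) /\ (forall v, V2 v -> B v -> v = y) /\
    (forall v, V1 v -> V2 v -> False).
Proof.
  induction n as [n IH] using lt_wf_ind; intros B a x V E P Aa Bx VK VB Sep.
  destruct (Sep x) as (r & b & Ar & Bb & VR & ER & R & RK & _).
  destruct (path_first _ _ _ _ B R) as (w & VR' & ER' & R' & Bw & RB & RR & _).
  { exists b; split; auto; eapply path_end; eauto. }
  assert (Nx : ~ VR' x) by (intro F; apply RR, RK in F; tauto).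
  assert (RK' : forall v, VR' v -> K v) by (intros v F; apply RR, RK in F; tauto).
  assert (P0 : path a x V E) by (exists n; auto).
  destruct (classic (exists v, VR' v /\ V v)) as [Meet|NoMeet].
  2:{ exists a, r, w, V, E, VR', ER'; repeat split; auto.
      intros v ? ?; apply NoMeet; eauto. }
  destruct (path_first _ _ _ _ V (path_rev _ _ _ _ R') Meet)
    as (v & VQ & EQ & Q & Vv & QV & QR & _).
  apply path_rev in Q.
  assert (QK : forall u, VQ u -> K u) by auto.
  assert (QB : forall u, VQ u -> B u -> u = w) by auto.
  assert (NQ : ~ VQ x) by auto.
  clear RR RK RK' RB R R' Meet.
  destruct (pathn_split _ _ _ _ _ _ P Vv)
    as (n1 & n2 & Va & Ea & Vb & Eb & Pa & Pb & -> & -> & -> & Dab).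
  assert (Nvx : v <> x) by (intros ->; path_ends; auto).
  assert (n1 < n1 + n2) by (inversion Pb; subst; [tauto|lia]).
  assert (Pb' : path v x Vb Eb) by (exists n2; auto).
  assert (Pa' : path a v Va Ea) by (exists n1; auto).
  path_ends.
  destruct (IH n1 H (cup B (cup Vb VQ)) a v Va Ea Pa Aa) as
    (a1 & a2 & y & V1 & E1 & V2 & E2 & A1 & A2 & By & P1 & P2 & K1 & K2 & B1 & B2 & D12).
  - unfold cup; auto.
  - intros; apply VK; left; auto.
  - sets.
  - intro z; destruct (Sep z) as (c & d & ? & ? & ?); exists c, d; unfold cup; auto.
  - clear IH Sep P P0 Pa Pa' Pb.
    assert (BK : forall u, Vb u -> K u) by (intros; apply VK; right; auto).
    assert (PQ : path a1 w (cup V1 VQ) (cup E1 EQ)) by (eapply path_app; eauto; sets).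
    assert (PB : path a1 x (cup V1 Vb) (cup E1 Eb)) by (eapply path_app; eauto; sets).
    assert (Yv : y <> v) by (intros ->; path_ends; eauto).
    path_ends.
    (* One path must be continued to [x] and the other to [w], unless it has already reached [B].
       The case [y = x] comes first: there the second path is complete, and the first must take the
       tail to [w]. *)
    destruct (classic (y = x)) as [->|Nyx]; [|destruct By as [By|[By|By]]].
    + exists a2, a1, w, V2, E2, (cup V1 VQ), (cup E1 EQ); repeat split; auto; sets.
    + exists a1, a2, y, (cup V1 Vb), (cup E1 Eb), V2, E2; repeat split; auto; sets.
    + destruct (path_split _ _ _ _ _ Pb' By) as (Vc & Ec & Vd & Ed & Pc & Pd & -> & -> & Dcd).
      assert (PP : path a2 x (cup V2 Vd) (cup E2 Ed)) by (eapply path_app; eauto; sets).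
      path_ends.
      exists a2, a1, w, (cup V2 Vd), (cup E2 Ed), (cup V1 VQ), (cup E1 EQ);
        repeat split; auto; sets.
    + destruct (path_split _ _ _ _ _ Q By) as (Vc & Ec & Vd & Ed & Pc & Pd & -> & -> & Dcd).
      assert (PP : path a2 w (cup V2 Vd) (cup E2 Ed)) by (eapply path_app; eauto; sets).
      path_ends.
      exists a1, a2, w, (cup V1 Vb), (cup E1 Eb), (cup V2 Vd), (cup E2 Ed);
        repeat split; auto; sets.
Qed.

(** The hypothesis says that no single vertex separates [A] from [B] within [K]. One path, read off
    at [z0] and stopped at its first vertex of [B], is augmented once. *)
Lemma two_disjoint_paths K A B z0 :
  (forall z, exists a b, A a /\ B b /\ conn (fun v => K v /\ v <> z) all_edges a b) ->
  exists a1 b1 a2 b2 V1 E1 V2 E2,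
    A a1 /\ B b1 /\ A a2 /\ B b2 /\ path a1 b1 V1 E1 /\ path a2 b2 V2 E2 /\
    (forall v, V1 v -> K v) /\ (forall v, V2 v -> K v) /\
    (forall v, V1 v -> B v -> v = b1) /\ (forall v, V2 v -> B v -> v = b2) /\
    (forall v, V1 v -> V2 v -> False).
Proof.
  intro Sep; destruct (Sep z0) as (a & b & Aa & Bb & V & E & P & KV & _).
  destruct (path_first _ _ _ _ B P) as (x & V' & E' & P' & Bx & VB & VV & _).
  { exists b; split; auto; eapply path_end; eauto. }
  assert (P0 := P'); destruct P' as [n P'].
  destruct (two_paths_extend K A n B a x V' E' P' Aa Bx) as
    (a1 & a2 & y & V1 & E1 & V2 & E2 & ?); auto.
  - intros v Hv; apply KV; auto.
  - exists a1, x, a2, y, V1, E1, V2, E2; intuition.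
Qed.

Lemma path_nonempty x y V E : @path G x y V E -> x <> y -> exists e, E e.
Proof. intros [n H] N; destruct H; [tauto|]; exists e; left; auto. Qed.

Lemma path_joins_ends x y V E e :
  @path G x y V E -> E e -> joins e x y -> forall g, E g -> g = e.
Proof.
  intros [n H] He J g Hg; destruct H as [|n x u y V E h Jh H N]; [tauto|].
  assert (P : path u y V E) by (exists n; auto).
  destruct He as [->|He].
  - destruct (joins_ends _ _ _ _ _ J Jh) as [[_ ->]|[-> ->]]; [|path_ends; tauto].
    inversion H; subst; [destruct Hg as [Hg|[]]; congruence|].
    exfalso; apply H2; eapply path_end; exists n0; eauto.
  - exfalso; apply N; eapply path_edge; eauto. apply (joins_in _ _ _ _ J); auto.
Qed.

(** Two internally disjoint paths that close up to a circuit; the last clause rules out a single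
    edge used twice. *)
Definition arcs p q V1 E1 V2 E2 :=
  @path G p q V1 E1 /\ path p q V2 E2 /\ p <> q /\
  (forall v, V1 v -> V2 v -> v = p \/ v = q) /\
  (exists e, (E1 e /\ ~ E2 e) \/ (E2 e /\ ~ E1 e)).

Definition cycle V E := exists p q V1 E1 V2 E2,
  arcs p q V1 E1 V2 E2 /\ V = cup V1 V2 /\ E = cup E1 E2.

Lemma cup_comm (T : Type) (X Y : T -> Prop) : cup X Y = cup Y X.
Proof. apply pred_ext; unfold cup; tauto. Qed.

Lemma cup_assoc (T : Type) (X Y Z : T -> Prop) : cup X (cup Y Z) = cup (cup X Y) Z.
Proof. apply pred_ext; unfold cup; tauto. Qed.

Lemma arcs_swap p q V1 E1 V2 E2 : arcs p q V1 E1 V2 E2 -> arcs p q V2 E2 V1 E1.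
Proof.
  intros (A & B & C & D & e & H); repeat split; auto.
  exists e; tauto.
Qed.

Lemma arcs_rev p q V1 E1 V2 E2 : arcs p q V1 E1 V2 E2 -> arcs q p V1 E1 V2 E2.
Proof.
  intros (A & B & C & D & e & H); repeat split; auto using path_rev.
  - intros v a b; destruct (D v a b); auto.
  - exists e; tauto.
Qed.

Lemma arcs_disjoint p q V1 E1 V2 E2 e :
  arcs p q V1 E1 V2 E2 -> E1 e -> E2 e -> False.
Proof.
  intros (A & B & C & D & g & H) H1 H2; destruct (joins_exists e) as [u [v J]].
  assert (X : forall w, proj1_sig e w -> w = p \/ w = q)
    by (intros w Hw; apply D; eapply path_edge; eauto).
  assert (Jpq : joins e p q).
  { assert (N := joins_neq _ _ _ J).
    destruct (X u), (X v); try (apply (joins_in _ _ _ _ J); auto; fail);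
      subst; try tauto; auto using joins_sym. }
  destruct H as [[K L]|[K L]]; apply L.
  - rewrite (path_joins_ends _ _ _ _ _ A H1 Jpq _ K); auto.
  - rewrite (path_joins_ends _ _ _ _ _ B H2 Jpq _ K); auto.
Qed.

Lemma cycle_circuit V E : cycle V E -> circuit G E.
Proof.
  intros (p & q & V1 & E1 & V2 & E2 & (A & B & C & D & F) & _ & ->).
  eapply circuit_of_paths; eauto.
Qed.

(** The segment of the first arc between [q] and [t] is moved to the second arc. Two such moves turn
    any two distinct vertices of a cycle into its base points. *)
Lemma arcs_slide p t q V1 E1 V2 E2 :
  arcs p t V1 E1 V2 E2 -> V1 q -> q <> p ->
  exists W1 F1 W2 F2, arcs p q W1 F1 W2 F2 /\
    cup V1 V2 = cup W1 W2 /\ cup E1 E2 = cup F1 F2.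
Proof.
  intros H Vq N; destruct (classic (q = t)) as [->|Nt].
  { exists V1, E1, V2, E2; auto. }
  assert (Dis := fun e => arcs_disjoint _ _ _ _ _ _ e H).
  destruct H as (A & B & C & D & _).
  destruct (path_split _ _ _ _ _ A Vq) as (Va & Ea & Vb & Eb & Pa & Pb & -> & -> & Dab).
  path_ends; apply path_rev in Pb.
  exists Va, Ea, (cup V2 Vb), (cup E2 Eb); repeat split; auto.
  - eapply path_app; eauto; sets.
  - sets.
  - destruct (path_nonempty _ _ _ _ Pa (not_eq_sym N)) as [e He].
    exists e; left; split; auto. intros [F|F]; [apply (Dis e); unfold cup; auto|].
    eapply path_edges_disjoint; [exact Pa|exact Pb|eauto|eauto|eauto].
  - rewrite (cup_comm _ V2), cup_assoc; auto.
  - rewrite (cup_comm _ E2), cup_assoc; auto.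
Qed.

Lemma cycle_arcs V E p q :
  cycle V E -> V p -> V q -> p <> q -> exists V1 E1 V2 E2,
    arcs p q V1 E1 V2 E2 /\ V = cup V1 V2 /\ E = cup E1 E2.
Proof.
  assert (Slide : forall V E p t q V1 E1 V2 E2, arcs p t V1 E1 V2 E2 ->
    V = cup V1 V2 -> E = cup E1 E2 -> V q -> q <> p ->
    exists V1 E1 V2 E2, arcs p q V1 E1 V2 E2 /\ V = cup V1 V2 /\ E = cup E1 E2).
  { clear V E p q; intros V E p t q V1 E1 V2 E2 H -> -> Vq N; destruct Vq as [Vq|Vq].
    - destruct (arcs_slide _ _ _ _ _ _ _ H Vq N) as (? & ? & ? & ? & ? & ? & ?); eauto 8.
    - rewrite (cup_comm _ V1), (cup_comm _ E1).
      destruct (arcs_slide _ _ _ _ _ _ _ (arcs_swap _ _ _ _ _ _ H) Vq N)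
        as (? & ? & ? & ? & ? & ? & ?); eauto 8. }
  intros (s & t & V1 & E1 & V2 & E2 & H & HV & HE) Vp Vq N.
  destruct (classic (p = s)) as [->|Ns].
  - eapply Slide; eauto.
  - destruct (Slide V E s t p V1 E1 V2 E2 H HV HE Vp Ns) as (? & ? & ? & ? & K & ? & ?).
    eapply Slide; eauto. apply arcs_rev; eauto.
Qed.

Lemma cycle_of_arcs p q V1 E1 V2 E2 :
  arcs p q V1 E1 V2 E2 -> cycle (cup V1 V2) (cup E1 E2).
Proof. intro H; exists p, q, V1, E1, V2, E2; auto. Qed.

Lemma cycle_edge V E e v : cycle V E -> E e -> proj1_sig e v -> V v.
Proof.
  intros (p & q & V1 & E1 & V2 & E2 & (A & B & _) & -> & ->) [H|H] Hv;
    [left|right]; eapply path_edge; eauto.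
Qed.

(** Menger between the end sets of the two edges: two disjoint paths use up both ends of each edge,
    so together with the edges they form a circuit. One path may be trivial, if the edges share an
    end. *)
Lemma cycle_through_edges K e1 e2 :
  e1 <> e2 -> (forall v, proj1_sig e1 v -> K v) -> (forall v, proj1_sig e2 v -> K v) ->
  (forall z, exists a b, proj1_sig e1 a /\ proj1_sig e2 b /\
     conn (fun v => K v /\ v <> z) all_edges a b) ->
  exists m1 n1 m2 n2 M EM N EN,
    joins e1 m1 n1 /\ joins e2 m2 n2 /\ path m1 m2 M EM /\ path n1 n2 N EN /\
    (forall v, M v -> K v) /\ (forall v, N v -> K v) /\ (forall v, M v -> N v -> False).
Proof.
  intros Ne K1 K2 Sep; destruct (joins_exists e1) as [x1 [y1 J1]], (joins_exists e2) as [x2 [y2 J2]].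
  destruct (two_disjoint_paths K (proj1_sig e1) (proj1_sig e2) x1 Sep) as
    (m1 & m2 & n1 & n2 & M & EM & N & EN & H1 & H2 & H3 & H4 & PM & PN & KM & KN & _ & _ & D).
  assert (X : forall e a b, proj1_sig e a -> proj1_sig e b -> a <> b -> joins e a b).
  { intros e a b Ha Hb N'; destruct (in_joins _ _ Ha) as [c J].
    destruct (proj1 (joins_in _ _ _ _ J) Hb); subst; auto; tauto. }
  path_ends.
  exists m1, n1, m2, n2, M, EM, N, EN; repeat split; auto;
    apply X; auto; intros ->; eauto.
Qed.

Definition ladder e1 e2 (EM EN : edge G -> Prop) : edge G -> Prop :=
  cup EM (cup (eq e1) (cup EN (eq e2))).

Lemma ladder_cycle m1 n1 m2 n2 M EM N EN e1 e2 :
  e1 <> e2 -> joins e1 m1 n1 -> joins e2 m2 n2 -> path m1 m2 M EM -> path n1 n2 N EN ->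
  (forall v, M v -> N v -> False) ->
  cycle (cup M N) (ladder e1 e2 EM EN).
Proof.
  unfold ladder; intros Ne J1 J2 PM PN D.
  assert (N1 : forall v, N v -> v <> m1) by (intros v H ->; path_ends; eauto).
  (* If the edges meet in [m1 = m2], the trivial path [M] cannot be an arc; then [e2] alone is one
     arc and [e1] followed by [N] the other. *)
  destruct (classic (m1 = m2)) as [->|Nm].
  - assert (M = eq m2 /\ EM = fun _ => False) as [-> ->].
    { destruct PM as [n PM]; inversion PM; subst; auto.
      exfalso; apply H1; eapply path_end; exists n0; eauto. }
    assert (P1 : path m2 n2 (cup (eq m2) N) (cup (eq e1) EN)).
    { eapply path_cons; eauto; intro F; eapply N1; eauto. }
    replace (cup (eq m2) N) with (cup (cup (eq m2) N) (upair m2 n2)).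
    2:{ apply pred_ext; intro v; unfold cup, upair; path_ends; split; intuition (subst; auto). }
    replace (cup (fun _ => False) (cup (eq e1) (cup EN (eq e2)))) with (cup (cup (eq e1) EN) (eq e2))
      by (apply pred_ext; unfold cup; tauto).
    exists m2, n2, (cup (eq m2) N), (cup (eq e1) EN), (upair m2 n2), (eq e2).
    repeat split; eauto using path_single, joins_neq.
    exists e1; left; split; [left|]; auto.
  - assert (P1 : path m1 n2 (cup (eq m1) N) (cup (eq e1) EN)).
    { eapply path_cons; eauto; intro F; eapply N1; eauto. }
    assert (P2 : path m1 m2 (cup (cup (eq m1) N) (upair n2 m2)) (cup (cup (eq e1) EN) (eq e2))).
    { eapply path_app; eauto using path_single, joins_sym.
      intros v [<-|H] [F|F]; subst; auto; path_ends; exfalso; eauto. }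
    replace (cup M N) with (cup M (cup (cup (eq m1) N) (upair n2 m2))).
    2:{ apply pred_ext; intro v; unfold cup, upair; path_ends; split; intuition (subst; auto). }
    replace (cup EM (cup (eq e1) (cup EN (eq e2)))) with (cup EM (cup (cup (eq e1) EN) (eq e2)))
      by (apply pred_ext; unfold cup; tauto).
    eapply cycle_of_arcs; repeat split; eauto.
    + path_ends; intros v Hv [[Q|Q]|[Q|Q]]; subst; auto; exfalso; eauto.
    + exists e1; right; split; [left; left; auto|].
      intro F; apply (D n1); path_ends; auto.
      eapply path_edge; eauto; apply (joins_in _ _ _ _ J1); auto.
Qed.

End Menger.

(** * Consequences of 3-connectedness *)

Section ThreeConnected.
Context {G : graph}.
Hypothesis H3 : k_connected 3 G.
Implicit Types (x y z u v a b s t : G) (e g h : edge G).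

Lemma another_vertex a b c : exists v, v <> a /\ v <> b /\ v <> c.
Proof.
  destruct H3 as [[l [ND L]] _]; apply NNPP; intro F.
  assert (I : incl l [a; b; c]).
  { intros v _; apply NNPP; intro Nv; apply F; exists v; simpl in Nv.
    repeat split; intros ->; tauto. }
  apply (NoDup_incl_length ND) in I; simpl in I; lia.
Qed.

Lemma conn_avoiding s t x y :
  x <> s -> x <> t -> y <> s -> y <> t ->
  conn (fun v => v <> s /\ v <> t) all_edges x y.
Proof.
  intros Xs Xt Ys Yt.
  assert (NI : forall v, v <> s -> v <> t -> ~ In v [s; t]) by (simpl; intuition congruence).
  destruct (proj2 H3 [s; t] (le_n _) x y (NI _ Xs Xt) (NI _ Ys Yt)) as (n & p & P0 & Pn & A & B).
  assert (Q : forall i, i <= n -> conn (fun v => v <> s /\ v <> t) all_edges (p 0) (p i)).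
  { induction i as [|i IH]; intro L.
    - apply conn_refl; rewrite P0; auto.
    - eapply conn_trans; [apply IH; lia|].
      destruct (adj_joins _ _ (B i L)) as [e J].
      assert (X : forall j, j <= n -> p j <> s /\ p j <> t)
        by (intros j Hj; specialize (A j Hj); simpl in A; intuition congruence).
      eapply conn_edge; [exact J|apply X; lia|apply X; lia|exact I]. }
  rewrite <- P0, <- Pn; apply Q; auto.
Qed.

(** Minimum degree three: the first step of a path that avoids [a] and [b] and leads from [x] to a
    further vertex. *)
Lemma third_neighbour x a b : x <> a -> x <> b -> exists e y, joins e x y /\ y <> a /\ y <> b.
Proof.
  intros Xa Xb; destruct (another_vertex x a b) as [v [Vx [Va Vb]]].
  destruct (conn_avoiding a b x v Xa Xb Va Vb) as (V & E & [n P] & K & _).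
  destruct P as [|n x y z V E e J P N]; [tauto|].
  exists e, y; split; auto; apply K; right; eapply path_start; exists n; eauto.
Qed.

Lemma conn_inside K F x y :
  conn K F x y -> conn K (fun e => F e /\ forall v, proj1_sig e v -> K v) x y.
Proof.
  intros (V & E & P & HK & HF); exists V, E; repeat split; auto.
  intros v Hv; apply HK; eapply path_edge; eauto.
Qed.

Lemma edges_not_separated e1 e2 z :
  exists a b, proj1_sig e1 a /\ proj1_sig e2 b /\
    conn (fun v => True /\ v <> z) all_edges a b.
Proof.
  assert (X : forall e, exists a, proj1_sig e a /\ a <> z).
  { intro e; destruct (joins_exists e) as [x [y J]].
    destruct (classic (x = z)) as [->|N].
    - exists y; split; [apply (joins_in _ _ _ _ J); auto|].
      intros ->; eapply joins_neq; eauto.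
    - exists x; split; auto; apply (joins_in _ _ _ _ J); auto. }
  destruct (X e1) as [a [? ?]], (X e2) as [b [? ?]]; exists a, b; repeat split; auto.
  apply (conn_mono (fun v => v <> z /\ v <> z) _ all_edges); try tauto.
  apply conn_avoiding; auto.
Qed.

(** Step from [x] to a neighbour other than [y], then reach [y] without returning to [x]. *)
Lemma edge_bypass e x y : joins e x y -> exists V E, path x y V E /\ ~ E e.
Proof.
  intro J; assert (N := joins_neq _ _ _ J).
  destruct (third_neighbour x y y N N) as (g & n & Jg & Nn & _).
  assert (Nx := joins_neq _ _ _ Jg).
  destruct (conn_avoiding x x n y) as (V & E & P & K & _); auto.
  assert (Vx : ~ V x) by (intro F; apply K in F; tauto).
  exists (cup (eq x) V), (cup (eq g) E); split; [eapply path_cons; eauto|].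
  intros [F|F].
  - subst g; destruct (joins_ends _ _ _ _ _ J Jg) as [[_ ?]|[_ ?]]; subst; congruence.
  - apply Vx; eapply path_edge; eauto; apply (joins_in _ _ _ _ J); auto.
Qed.

(** If both [M] and [N] have more than one vertex, deleting [m1] and [n2] destroys both edges and
    leaves a vertex on each side, still connected. If one of them is a single vertex, its third
    neighbour leads out along an edge other than [e1] and [e2]. *)
Lemma conn_avoiding_edges m1 n1 m2 n2 M EM N EN e1 e2 :
  joins e1 m1 n1 -> joins e2 m2 n2 -> path m1 m2 M EM -> path n1 n2 N EN ->
  (forall v, M v -> N v -> False) ->
  exists m n, M m /\ N n /\ conn (fun _ => True) (fun e => e <> e1 /\ e <> e2) m n.
Proof.
  intros J1 J2 PM PN D.
  assert (Single : forall m1 n1 m2 n2 M EM e1 e2,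
    joins e1 m1 n1 -> joins e2 m2 n2 -> path m1 m2 M EM -> (forall v, M v -> v = m1) ->
    conn (fun _ => True) (fun e => e <> e1 /\ e <> e2) m1 n1).
  { clear -H3; intros m1 n1 m2 n2 M EM e1 e2 J1 J2 PM S.
    assert (m2 = m1) by (apply S; eapply path_end; eauto); subst m2.
    assert (N1 := joins_neq _ _ _ J1). assert (N2 := joins_neq _ _ _ J2).
    destruct (third_neighbour m1 n1 n2 N1 N2) as (g & y & J & Y1 & Y2).
    assert (Q : forall e n, joins e m1 n -> y <> n -> g <> e).
    { intros e n Je Ny ->; destruct (joins_ends _ _ _ _ _ J Je) as [[_ ?]|[? ?]];
        subst; tauto. }
    assert (Ny := joins_neq _ _ _ J).
    apply (conn_step _ _ g m1 y); eauto.
    eapply conn_mono; [| |apply conn_inside; apply (conn_avoiding m1 m1 y n1)]; auto.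
    intros e [_ K]; simpl in K; split; intros ->.
    + destruct (K m1); [apply (joins_in _ _ _ _ J1); auto|tauto].
    + destruct (K m1); [apply (joins_in _ _ _ _ J2); auto|tauto]. }
  path_ends.
  destruct (classic (forall v, M v -> v = m1)) as [S|S].
  { exists m1, n1; repeat split; eauto. }
  destruct (classic (forall v, N v -> v = n1)) as [S'|S'].
  { exists m1, n1; repeat split; auto. apply conn_sym.
    eapply (Single n1 m1 n2 m2); eauto using joins_sym. }
  assert (exists a, M a /\ a <> m1) as [a [Ma Na]]
    by (apply NNPP; intro F; apply S; intros v Hv; apply NNPP; eauto).
  assert (exists b, N b /\ b <> n2) as [b [Nb Nbn]].
  { apply NNPP; intro F; apply S'.
    assert (A : forall v, N v -> v = n2) by (intros v Hv; apply NNPP; eauto).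
    intros v Hv; rewrite (A v), (A n1); auto. }
  exists a, b; repeat split; auto.
  eapply conn_mono; [| |apply conn_inside; apply (conn_avoiding m1 n2 a b)]; auto;
    try (intros ->; eauto; fail).
  intros e [_ K]; simpl in K; split; intros ->.
  - destruct (K m1); [apply (joins_in _ _ _ _ J1); auto|tauto].
  - destruct (K n2); [apply (joins_in _ _ _ _ J2); auto|tauto].
Qed.

End ThreeConnected.

(** * Injectivity of a circuit surjection *)

Section Injectivity.
Context {G G' : graph} (f : edge G -> edge G').
Hypothesis Hf : circuit_surjection f.
Implicit Types (x y z u v a b s t m n : G) (e g h : edge G).

(** If both edges lay on both paths, their ends would all be in [p], [q], and the edges would
    coincide. *)
Lemma arcs_of_distinct p q V1 E1 V2 E2 e1 e2 :
  @path G p q V1 E1 -> path p q V2 E2 -> p <> q ->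
  (forall v, V1 v -> V2 v -> v = p \/ v = q) ->
  E1 e1 -> E2 e2 -> e1 <> e2 -> arcs p q V1 E1 V2 E2.
Proof.
  intros P1 P2 N D H1 H2 Ne; repeat split; auto.
  destruct (classic (E2 e1)) as [F1|]; [|eauto].
  destruct (classic (E1 e2)) as [F2|]; [|eauto].
  exfalso; apply Ne, (edge_eq_of_ends _ _ p q); intros v Hv; apply D;
    (eapply path_edge; [| |exact Hv]); eauto.
Qed.

Lemma arcs_of_missing p q V1 E1 V2 E2 e :
  @path G p q V1 E1 -> path p q V2 E2 -> p <> q ->
  (forall v, V1 v -> V2 v -> v = p \/ v = q) ->
  E1 e -> ~ E2 e -> arcs p q V1 E1 V2 E2.
Proof. intros; repeat split; eauto. Qed.

(* A colour common to A1 and A2 lies in all three circuit images, so no symmetric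
   difference of two of them is the third. *)
Lemma theta_image p q V1 E1 V2 E2 V3 E3 e1 e2 :
  arcs p q V1 E1 V2 E2 -> arcs p q V1 E1 V3 E3 -> arcs p q V2 E2 V3 E3 ->
  E1 e1 -> E2 e2 -> f e1 = f e2 ->
  eimage f (cup E1 E2) = eimage f (cup E1 E3).
Proof.
  intros A12 A13 A23 I1 I2 Ef.
  apply (circuit_symdiff _ _ (eimage f (cup E2 E3)));
    try (apply Hf; eapply cycle_circuit, cycle_of_arcs; eauto).
  - intros e' [e [[K|K] <-]] N; [exfalso; apply N|]; exists e; unfold cup; auto.
  - intros e' [e [[K|K] <-]] N; [exfalso; apply N|]; exists e; unfold cup; auto.
  - exists (f e1); repeat split; [exists e1|exists e1|exists e2]; unfold cup; auto.
Qed.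

(** The circuit runs through [A0], [A1], [B], [A2], with a chord [VR] from [m] to [z]. The theta
    with ends [m] and [z] equates its image with that of [F0] and [ER], where [B] no longer appears;
    so [B] may be exchanged for [C]. *)
Lemma image_switch_side m x y z A0 F0 A1 F1 A2 F2 B FB C FC VR ER e1 e2 :
  path m z A0 F0 -> path z x A1 F1 -> path m y A2 F2 -> path x y B FB ->
  path x y C FC -> path m z VR ER ->
  F0 e1 -> F2 e2 -> ~ ER e1 -> ~ ER e2 -> e1 <> e2 -> f e1 = f e2 -> m <> z ->
  (forall v, A0 v -> A1 v -> v = z) -> (forall v, A0 v -> A2 v -> v = m) ->
  (forall v, A0 v -> B v -> v = z) -> (forall v, A0 v -> C v -> v = z) ->
  (forall v, A1 v -> A2 v -> False) ->
  (forall v, A1 v -> B v -> v = x) -> (forall v, A1 v -> C v -> v = x) ->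
  (forall v, A2 v -> B v -> v = y) -> (forall v, A2 v -> C v -> v = y) ->
  (forall v, VR v -> A0 v -> v = m \/ v = z) -> (forall v, VR v -> A1 v -> v = z) ->
  (forall v, VR v -> A2 v -> v = m) ->
  (forall v, VR v -> B v -> v = z) -> (forall v, VR v -> C v -> v = z) ->
  forall e, FC e -> eimage f (cup F0 (cup (cup F2 FB) F1)) (f e).
Proof.
  intros P0 P1 P2 PB PC PR I1 I2 R1 R2 Ne Ef Nmz D01 D02 D0B D0C D12 D1B D1C D2B D2C
    DR0 DR1 DR2 DRB DRC e He.
  assert (P1' := path_rev _ _ _ _ P1).
  assert (Key : forall B FB, path y x B FB -> (forall v, A0 v -> B v -> v = z) ->
    (forall v, A1 v -> B v -> v = x) -> (forall v, A2 v -> B v -> v = y) ->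
    (forall v, VR v -> B v -> v = z) ->
    eimage f (cup F0 (cup (cup F2 FB) F1)) = eimage f (cup F0 ER)).
  { clear B FB PB D0B D1B D2B DRB; intros B FB PB D0B D1B D2B DRB; path_ends.
    assert (Q : path m x (cup A2 B) (cup F2 FB)) by (eapply path_app; eauto; sets).
    assert (W : path m z (cup (cup A2 B) A1) (cup (cup F2 FB) F1))
      by (eapply path_app; eauto; sets).
    eapply theta_image.
    - apply (arcs_of_distinct m z _ _ _ _ e1 e2 P0 W); unfold cup; auto. sets.
    - apply (arcs_of_missing m z _ _ _ _ e1 P0 PR); auto.
    - apply (arcs_of_missing m z _ _ _ _ e2 W PR); unfold cup; auto. sets.
    - exact I1.
    - left; left; exact I2.
    - exact Ef. }
  rewrite (Key B FB), <- (Key C FC); auto using path_rev.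
  exists e; unfold cup; auto.
Qed.

(** Two thetas share the circuit made of [A1], [B1] and [VR]: one with ends [m], [z], whose third
    arc is [A2], [B2], and one with ends [m], [x], whose third arc is [A2], [C]. Both remaining
    circuits have the image of the shared one. *)
Lemma image_switch_middle m x y z A1 F1 A2 F2 B1 FB1 B2 FB2 C FC VR ER e1 e2 :
  path m x A1 F1 -> path m y A2 F2 -> path x z B1 FB1 -> path z y B2 FB2 ->
  path x y C FC -> path m z VR ER ->
  F1 e1 -> F2 e2 -> ~ ER e1 -> ~ ER e2 -> e1 <> e2 -> f e1 = f e2 ->
  m <> z -> m <> x ->
  (forall v, A1 v -> A2 v -> v = m) ->
  (forall v, A1 v -> B1 v -> v = x) -> (forall v, A1 v -> B2 v -> False) ->
  (forall v, A1 v -> C v -> v = x) ->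
  (forall v, A2 v -> B1 v -> False) -> (forall v, A2 v -> B2 v -> v = y) ->
  (forall v, A2 v -> C v -> v = y) ->
  (forall v, B1 v -> B2 v -> v = z) ->
  (forall v, C v -> B1 v -> v = x) ->
  (forall v, VR v -> A1 v -> v = m) -> (forall v, VR v -> A2 v -> v = m) ->
  (forall v, VR v -> B1 v -> v = z) -> (forall v, VR v -> B2 v -> v = z) ->
  (forall v, VR v -> C v -> False) ->
  eimage f (cup (cup F1 FB1) (cup F2 FB2)) = eimage f (cup F1 (cup F2 FC)).
Proof.
  intros P1 P2 PB1 PB2 PC PR I1 I2 R1 R2 Ne Ef Nmz Nmx D12 D11 D1B D1C D21 D22 D2C DB DC1
    DR1 DR2 DRB1 DRB2 DRC.
  assert (PC' := path_rev _ _ _ _ PC). assert (PB1' := path_rev _ _ _ _ PB1). path_ends.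
  assert (Q1 : path m z (cup A1 B1) (cup F1 FB1)) by (eapply path_app; eauto; sets).
  assert (Q2 : path m z (cup A2 B2) (cup F2 FB2))
    by (eapply path_app; [exact P2|apply path_rev; exact PB2|]; sets).
  assert (Q3 : path m x (cup A2 C) (cup F2 FC)) by (eapply path_app; eauto; sets).
  assert (Q4 : path m x (cup VR B1) (cup ER FB1)) by (eapply path_app; eauto; sets).
  assert (NB1 : ~ FB1 e1).
  { intro F; exact (path_edges_disjoint _ _ _ _ _ _ _ _ _ _ P1 PB1 D11 I1 F). }
  assert (NB2 : ~ FB1 e2).
  { intro F. refine (path_edges_disjoint _ _ _ _ _ _ _ _ x _ P2 PB1 _ I2 F). sets. }
  transitivity (eimage f (cup (cup F1 FB1) ER)).
  - eapply theta_image.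
    + apply (arcs_of_distinct m z _ _ _ _ e1 e2 Q1 Q2); unfold cup; auto. sets.
    + apply (arcs_of_missing m z _ _ _ _ e1 Q1 PR); unfold cup; auto. sets.
    + apply (arcs_of_missing m z _ _ _ _ e2 Q2 PR); unfold cup; auto. sets.
    + left; exact I1.
    + left; exact I2.
    + exact Ef.
  - replace (cup (cup F1 FB1) ER) with (cup F1 (cup ER FB1))
      by (apply pred_ext; unfold cup; tauto).
    symmetry; eapply theta_image.
    + apply (arcs_of_distinct m x _ _ _ _ e1 e2 P1 Q3); unfold cup; auto. sets.
    + apply (arcs_of_missing m x _ _ _ _ e1 P1 Q4); unfold cup; auto; [sets|tauto].
    + apply (arcs_of_missing m x _ _ _ _ e2 Q3 Q4); unfold cup; auto; [sets|tauto].
    + exact I1.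
    + left; exact I2.
    + exact Ef.
Qed.

Lemma eimage_mono (E F : edge G -> Prop) (e' : edge G') :
  (forall e, E e -> F e) -> eimage f E e' -> eimage f F e'.
Proof. intros H [e [K L]]; exists e; auto. Qed.

(* In the lemmas on ears, X1 and X2 run from m to the ends n1 and n2 of a path
   N1 B N2 and contain e1 and e2; C is the ear and VR links m to a vertex z. *)
Lemma image_ear_side m n1 n2 x y z X1 E1 X2 E2 N1 F1 N2 F2 B FB C FC VR ER e1 e2 :
  path m n1 X1 E1 -> path m n2 X2 E2 -> path n1 x N1 F1 -> path n2 y N2 F2 ->
  path x y B FB -> path x y C FC -> path m z VR ER ->
  E1 e1 -> E2 e2 -> ~ ER e1 -> ~ ER e2 -> e1 <> e2 -> f e1 = f e2 -> m <> z ->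
  (forall v, X1 v -> X2 v -> v = m) ->
  (forall v, X1 v -> N1 v -> v = n1) -> (forall v, X1 v -> N2 v -> False) ->
  (forall v, X2 v -> N2 v -> v = n2) -> (forall v, X2 v -> N1 v -> False) ->
  (forall v, N1 v -> N2 v -> False) ->
  (forall v, N1 v -> B v -> v = x) -> (forall v, N1 v -> C v -> v = x) ->
  (forall v, N2 v -> B v -> v = y) -> (forall v, N2 v -> C v -> v = y) ->
  (forall v, X1 v -> B v -> v = x) -> (forall v, X1 v -> C v -> v = x) ->
  (forall v, X2 v -> B v -> v = y) -> (forall v, X2 v -> C v -> v = y) ->
  (forall v, VR v -> X1 v -> v = m \/ v = z) -> (forall v, VR v -> X2 v -> v = m \/ v = z) ->
  (forall v, VR v -> N1 v -> v = z) -> (forall v, VR v -> N2 v -> v = z) ->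
  (forall v, VR v -> B v -> v = z) -> (forall v, VR v -> C v -> v = z) ->
  N1 z ->
  forall e, FC e ->
    eimage f (cup E1 (cup E2 (cup F1 (cup F2 FB)))) (f e).
Proof.
  intros PX1 PX2 PN1 PN2 PB PC PR I1 I2 R1 R2 Ne Ef Nmz DXX D11 D12 D22 D21 DNN
    D1B D1C D2B D2C DX1B DX1C DX2B DX2C RX1 RX2 RN1 RN2 RB RC Z e He.
  destruct (path_split _ _ _ _ _ PN1 Z) as (Na & Fa & Nb & Fb & Pa & Pb & -> & -> & Dab).
  path_ends.
  assert (A0 : path m z (cup X1 Na) (cup E1 Fa)) by (eapply path_app; eauto; sets).
  assert (A2 : path m y (cup X2 N2) (cup E2 F2)) by (eapply path_app; eauto; sets).
  eapply (eimage_mono (cup (cup E1 Fa) (cup (cup (cup E2 F2) FB) Fb)));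
    [unfold cup; intuition|].
  eapply (image_switch_side m x y z (cup X1 Na) _ Nb _ (cup X2 N2) _ B FB C FC VR ER e1 e2);
    try (left; assumption); eauto.
  all: sets.
Qed.

Lemma image_ear_middle m n1 n2 x y z X1 E1 X2 E2 N1 F1 N2 F2 B FB C FC VR ER e1 e2 :
  path m n1 X1 E1 -> path m n2 X2 E2 -> path n1 x N1 F1 -> path n2 y N2 F2 ->
  path x y B FB -> path x y C FC -> path m z VR ER ->
  E1 e1 -> E2 e2 -> ~ ER e1 -> ~ ER e2 -> e1 <> e2 -> f e1 = f e2 -> m <> z ->
  m <> x -> x <> y -> z <> x -> z <> y ->
  (forall v, X1 v -> X2 v -> v = m) ->
  (forall v, X1 v -> N1 v -> v = n1) -> (forall v, X1 v -> N2 v -> False) ->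
  (forall v, X2 v -> N2 v -> v = n2) -> (forall v, X2 v -> N1 v -> False) ->
  (forall v, N1 v -> N2 v -> False) ->
  (forall v, N1 v -> B v -> v = x) -> (forall v, N1 v -> C v -> v = x) ->
  (forall v, N2 v -> B v -> v = y) -> (forall v, N2 v -> C v -> v = y) ->
  (forall v, X1 v -> B v -> v = x) -> (forall v, X1 v -> C v -> v = x) ->
  (forall v, X2 v -> B v -> v = y) -> (forall v, X2 v -> C v -> v = y) ->
  (forall v, B v -> C v -> v = x \/ v = y) ->
  (forall v, VR v -> X1 v -> v = m \/ v = z) -> (forall v, VR v -> X2 v -> v = m \/ v = z) ->
  (forall v, VR v -> N1 v -> v = z) -> (forall v, VR v -> N2 v -> v = z) ->
  (forall v, VR v -> B v -> v = z) -> (forall v, VR v -> C v -> v = z) ->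
  B z ->
  eimage f (cup E1 (cup E2 (cup F1 (cup F2 FB)))) = 
  eimage f (cup E1 (cup E2 (cup F1 (cup F2 FC)))).
Proof.
  intros PX1 PX2 PN1 PN2 PB PC PR I1 I2 R1 R2 Ne Ef Nmz Nmx Nxy Nzx Nzy DXX D11 D12 D22 D21 DNN
    D1B D1C D2B D2C DX1B DX1C DX2B DX2C DBC RX1 RX2 RN1 RN2 RB RC Z.
  destruct (path_split _ _ _ _ _ PB Z) as (Ba & Fa & Bb & Fb & Pa & Pb & -> & -> & Dab).
  path_ends.
  assert (A1 : path m x (cup X1 N1) (cup E1 F1)) by (eapply path_app; eauto; sets).
  assert (A2 : path m y (cup X2 N2) (cup E2 F2)) by (eapply path_app; eauto; sets).
  replace (cup E1 (cup E2 (cup F1 (cup F2 (cup Fa Fb)))))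
    with (cup (cup (cup E1 F1) Fa) (cup (cup E2 F2) Fb))
    by (apply pred_ext; unfold cup; tauto).
  replace (cup E1 (cup E2 (cup F1 (cup F2 FC))))
    with (cup (cup E1 F1) (cup (cup E2 F2) FC))
    by (apply pred_ext; unfold cup; tauto).
  eapply (image_switch_middle m x y z (cup X1 N1) _ (cup X2 N2) _ Ba Fa Bb Fb C FC VR ER e1 e2);
    try (left; assumption); eauto.
  all: sets.
Qed.

(** The position of [z] decides. On [N1] or [N2], which contain [x] and [y], the side switch
    applies; inside [B] or [C] it is the middle switch, with [B] and [C] exchanged in the second
    case. *)
Lemma image_ordered_ear m n1 n2 x y z X1 E1 X2 E2 N1 F1 N2 F2 B FB C FC VR ER e1 e2 :
  path m n1 X1 E1 -> path m n2 X2 E2 -> path n1 x N1 F1 -> path n2 y N2 F2 ->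
  path x y B FB -> path x y C FC -> path m z VR ER ->
  E1 e1 -> E2 e2 -> ~ ER e1 -> ~ ER e2 -> e1 <> e2 -> f e1 = f e2 -> m <> z ->
  m <> x -> x <> y ->
  (forall v, X1 v -> X2 v -> v = m) ->
  (forall v, X1 v -> N1 v -> v = n1) -> (forall v, X1 v -> N2 v -> False) ->
  (forall v, X2 v -> N2 v -> v = n2) -> (forall v, X2 v -> N1 v -> False) ->
  (forall v, N1 v -> N2 v -> False) ->
  (forall v, N1 v -> B v -> v = x) -> (forall v, N1 v -> C v -> v = x) ->
  (forall v, N2 v -> B v -> v = y) -> (forall v, N2 v -> C v -> v = y) ->
  (forall v, X1 v -> B v -> v = x) -> (forall v, X1 v -> C v -> v = x) ->
  (forall v, X2 v -> B v -> v = y) -> (forall v, X2 v -> C v -> v = y) ->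
  (forall v, B v -> C v -> v = x \/ v = y) ->
  (forall v, VR v -> X1 v -> v = m \/ v = z) -> (forall v, VR v -> X2 v -> v = m \/ v = z) ->
  (forall v, VR v -> N1 v -> v = z) -> (forall v, VR v -> N2 v -> v = z) ->
  (forall v, VR v -> B v -> v = z) -> (forall v, VR v -> C v -> v = z) ->
  N1 z \/ N2 z \/ B z \/ C z ->
  forall e, FC e -> eimage f (cup E1 (cup E2 (cup F1 (cup F2 FB)))) (f e).
Proof.
  intros PX1 PX2 PN1 PN2 PB PC PR I1 I2 R1 R2 Ne Ef Nmz Nmx Nxy DXX D11 D12 D22 D21 DNN
    D1B D1C D2B D2C DX1B DX1C DX2B DX2C DBC RX1 RX2 RN1 RN2 RB RC Z e He.
  assert (Side1 : N1 z -> eimage f (cup E1 (cup E2 (cup F1 (cup F2 FB)))) (f e)).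
  { intro Hz; eapply (image_ear_side m n1 n2 x y z X1 E1 X2 E2 N1 F1 N2 F2 B FB C FC VR ER); eauto. }
  assert (Side2 : N2 z -> eimage f (cup E1 (cup E2 (cup F1 (cup F2 FB)))) (f e)).
  { intro Hz.
    eapply (eimage_mono (cup E2 (cup E1 (cup F2 (cup F1 FB))))); [unfold cup; tauto|].
    eapply (image_ear_side m n2 n1 y x z X2 E2 X1 E1 N2 F2 N1 F1 B FB C FC VR ER e2 e1);
      eauto using path_rev; sets. }
  destruct (classic (z = x)) as [->|Nzx]; [apply Side1; eapply path_end; eauto|].
  destruct (classic (z = y)) as [->|Nzy]; [apply Side2; eapply path_end; eauto|].
  destruct Z as [Z|[Z|[Z|Z]]]; auto.
  - rewrite (image_ear_middle m n1 n2 x y z X1 E1 X2 E2 N1 F1 N2 F2 B FB C FC VR ER e1 e2); auto.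
    exists e; unfold cup; auto 6.
  - rewrite <- (image_ear_middle m n1 n2 x y z X1 E1 X2 E2 N1 F1 N2 F2 C FC B FB VR ER e1 e2); auto.
    exists e; unfold cup; auto 6.
Qed.

Hypothesis H3 : k_connected 3 G.

(** An ear with both ends on [N] leaves [e1] and [e2] on the same arc of the circuit, so one theta
    does not suffice. A link from [M] to [N] or [C] that avoids both edges supplies the others. *)
Lemma image_ear m1 n1 m2 n2 M EM N EN e1 e2 x y C FC :
  joins e1 m1 n1 -> joins e2 m2 n2 -> path m1 m2 M EM -> path n1 n2 N EN ->
  (forall v, M v -> N v -> False) -> e1 <> e2 -> f e1 = f e2 ->
  x <> y -> N x -> N y -> path x y C FC ->
  (forall v, C v -> M v -> False) -> (forall v, C v -> N v -> v = x \/ v = y) ->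
  forall e, FC e -> eimage f (ladder e1 e2 EM EN) (f e).
Proof.
  intros J1 J2 PM PN D Ne Ef Nxy Nx Ny PC CM CN.
  destruct (conn_avoiding_edges H3 _ _ _ _ _ _ _ _ _ _ J1 J2 PM PN D)
    as (m0 & n0 & Mm & Nn & V & E & P & _ & AE).
  (* Trimming from both sides: [m] is the last vertex of the path on [M], and [z] the first vertex
     after it on [N] or [C]. *)
  destruct (path_first _ _ _ _ M (path_rev _ _ _ _ P)) as (m & V' & E' & P' & Mm' & Um & _ & AE').
  { exists m0; split; auto; eapply path_start; eauto. }
  destruct (path_first _ _ _ _ (cup N C) (path_rev _ _ _ _ P'))
    as (z & VR & ER & PR & Zz & Uz & RV & RE).
  { exists n0; split; [eapply path_start; eauto|left; auto]. }
  assert (R1 : ~ ER e1) by (intro F; apply RE, AE', AE in F; tauto).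
  assert (R2 : ~ ER e2) by (intro F; apply RE, AE', AE in F; tauto).
  assert (RM : forall v, VR v -> M v -> v = m) by auto.
  clear P P' V V' E E' AE AE' RV RE Um m0 n0 Mm Nn.
  assert (Nmz : m <> z) by (intros ->; destruct Zz; eauto).
  destruct (path_split _ _ _ _ _ PM Mm') as (Ma & Ea & Mb & Eb & Pa & Pb & -> & -> & Dab).
  assert (X1 : path m n1 (cup (eq n1) Ma) (cup (eq e1) Ea)).
  { apply path_rev; eapply path_cons; eauto using joins_sym.
    intro F; apply (D n1); [left; auto|eapply path_start; eauto]. }
  assert (X2 : path m n2 (cup (eq n2) Mb) (cup (eq e2) Eb)).
  { apply path_rev; eapply path_cons; eauto using joins_sym, path_rev.
    intro F; apply (D n2); [right; auto|eapply path_end; eauto]. }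
  (* Here [x] precedes [y] on the way from [n1] to [n2]; in the opposite order the ear is
     reversed. *)
  assert (Ordered : forall x y N1 F1 B FB N2 F2 C, x <> y ->
    path n1 x N1 F1 -> path x y B FB -> path y n2 N2 F2 -> path x y C FC ->
    N = cup N1 (cup B N2) -> EN = cup F1 (cup FB F2) ->
    (forall v, N1 v -> B v -> v = x) -> (forall v, N1 v -> N2 v -> False) ->
    (forall v, B v -> N2 v -> v = y) ->
    (forall v, C v -> cup Ma Mb v -> False) -> (forall v, C v -> N v -> v = x \/ v = y) ->
    cup N C z -> (forall v, VR v -> cup N C v -> v = z) ->
    forall e, FC e -> eimage f (ladder e1 e2 (cup Ea Eb) EN) (f e)).
  { clear x y C PC Nxy Nx Ny CM CN Zz Uz.
    intros x y N1 F1 B FB N2 F2 C Nxy P1 PB P2 PC HN HE D1B D12 DB2 CM CN Zz Uz e He.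
    assert (PN2 := path_rev _ _ _ _ P2).
    subst N EN.
    eapply (eimage_mono (cup (cup (eq e1) Ea) (cup (cup (eq e2) Eb) (cup F1 (cup F2 FB)))));
      [unfold ladder, cup; tauto|].
    assert (Nmx : m <> x).
    { intros ->; apply (D x); auto. right; left; eapply path_start; eauto. }
    path_ends.
    eapply (image_ordered_ear m n1 n2 x y z _ _ _ _ N1 F1 N2 F2 B FB C FC VR ER e1 e2 X1 X2);
      eauto; try (left; reflexivity).
    all: sets. }
  destruct (path_split _ _ _ _ _ PN Nx) as (Na & Fa & Nb & Fb & Qa & Qb & HN & HE & DN).
  assert (Ny' := Ny); rewrite HN in Ny'; destruct Ny' as [Ny'|Ny'].
  - destruct (path_split _ _ _ _ _ Qa Ny') as (Nc & Fc & Nd & Fd & Qc & Qd & -> & -> & DN').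
    path_ends.
    apply (Ordered y x Nc Fc Nd Fd Nb Fb C); auto using path_rev.
    + rewrite HN, cup_assoc; auto.
    + rewrite HE, cup_assoc; auto.
    + sets.
    + sets.
    + intros v a b; destruct (CN v a b); auto.
  - destruct (path_split _ _ _ _ _ Qb Ny') as (Nc & Fc & Nd & Fd & Qc & Qd & -> & -> & DN').
    path_ends.
    apply (Ordered x y Na Fa Nc Fc Nd Fd C); auto; sets.
Qed.

Lemma circuit_surjection_injective :
  ~ is_circuit_graph G' -> forall e1 e2, f e1 = f e2 -> e1 = e2.
Proof.
  intros NC e1 e2 Ef; apply NNPP; intro Ne; apply NC.
  destruct (cycle_through_edges (fun _ => True) e1 e2 Ne (fun _ _ => I) (fun _ _ => I)
              (edges_not_separated H3 e1 e2))
    as (m1 & n1 & m2 & n2 & M & EM & N & EN & J1 & J2 & PM & PN & _ & _ & D).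
  assert (Cyc := ladder_cycle _ _ _ _ _ _ _ _ _ _ Ne J1 J2 PM PN D).
  (* Once the image of the circuit through [e1] and [e2] contains every value of [f], it is all of
     [G'] by surjectivity. *)
  assert (All : forall e, eimage f (ladder e1 e2 EM EN) (f e)).
  2:{ unfold is_circuit_graph.
      replace (fun _ : edge G' => True) with (eimage f (ladder e1 e2 EM EN)).
      - apply Hf; eapply cycle_circuit; exact Cyc.
      - apply pred_ext; intro e'; split; auto; intros _.
        destruct (proj1 Hf e') as [e <-]; auto. }
  intro e; destruct (classic (ladder e1 e2 EM EN e)) as [L|NL]; [exists e; auto|].
  destruct (joins_exists e) as [u [v J]].
  (* Two disjoint paths from the ends of [e] to the circuit extend [e] to an ear. *)
  destruct (two_disjoint_paths (fun _ => True) (proj1_sig e) (cup M N) u) as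
    (a1 & x & a2 & y & V1 & E1 & V2 & E2 & H1 & Hx & H2 & Hy & P1 & P2 & _ & _ & U1 & U2 & D12).
  { intro w; destruct (edges_not_separated H3 e e1 w) as (a & b & A & B & C).
    exists a, b; repeat split; auto; path_ends.
    destruct (proj1 (joins_in _ _ _ _ J1) B); subst; [left|right]; auto. }
  assert (Na : a1 <> a2) by (intros ->; path_ends; eauto).
  assert (Ja : joins e a1 a2).
  { destruct (in_joins _ _ H1) as [c K].
    destruct (proj1 (joins_in _ _ _ _ K) H2); subst; auto; tauto. }
  assert (P2' : path a1 y (cup (eq a1) V2) (cup (eq e) E2)).
  { eapply path_cons; eauto; intro F; path_ends; eauto. }
  assert (PC : path x y (cup V1 (cup (eq a1) V2)) (cup E1 (cup (eq e) E2))).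
  { eapply path_app; [apply path_rev; exact P1|exact P2'|].
    intros w A [<-|B]; auto; exfalso; eauto. }
  assert (UC : forall w, cup V1 (cup (eq a1) V2) w -> cup M N w -> w = x \/ w = y).
  { path_ends; sets. }
  assert (He : cup E1 (cup (eq e) E2) e) by (right; left; auto).
  revert PC UC He; generalize (cup V1 (cup (eq a1) V2)) (cup E1 (cup (eq e) E2)).
  intros C FC PC UC He.
  assert (Nxy : x <> y) by (intros ->; path_ends; eauto).
  clear P1 P2 P2' V1 V2 E1 E2 U1 U2 D12 Na Ja H1 H2 a1 a2.
  (* An ear from [M] to [N] separates [e1] from [e2] on the circuit, so a single theta settles this
     case. *)
  assert (Across : forall x y C, x <> y -> path x y C FC -> M x -> N y ->
    (forall w, C w -> cup M N w -> w = x \/ w = y) ->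
    eimage f (ladder e1 e2 EM EN) (f e)).
  { clear x y C PC UC Hx Hy Nxy; intros x y C Nxy PC Mx Ny UC.
    destruct (path_split _ _ _ _ _ PM Mx) as (Ma & Ea & Mb & Eb & Pa & Pb & -> & -> & Dab).
    destruct (path_split _ _ _ _ _ PN Ny) as (Na & Fa & Nb & Fb & Qa & Qb & -> & -> & Dab').
    assert (A : path x y (cup (cup (eq n1) Ma) Na) (cup (cup (eq e1) Ea) Fa)).
    { eapply path_app; [apply path_rev; eapply path_cons; eauto using joins_sym| |];
        eauto; path_ends; sets. }
    assert (B : path x y (cup (cup (eq n2) Mb) Nb) (cup (cup (eq e2) Eb) Fb)).
    { eapply path_app; [apply path_rev; eapply path_cons; eauto using joins_sym, path_rev| |];
        eauto using path_rev; path_ends; sets. }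
    assert (Ne1 : ~ cup (cup (eq e1) Ea) Fa e) by (intro F; apply NL; unfold ladder, cup in *; tauto).
    assert (Ne2 : ~ cup (cup (eq e2) Eb) Fb e) by (intro F; apply NL; unfold ladder, cup in *; tauto).
    eapply (eimage_mono (cup (cup (cup (eq e1) Ea) Fa) (cup (cup (eq e2) Eb) Fb)));
      [unfold ladder, cup; tauto|].
    path_ends.
    erewrite (theta_image x y _ _ _ _ C FC e1 e2).
    - exists e; split; auto; right; auto.
    - eapply arcs_of_distinct; [exact A|exact B|auto| |left; left; eauto|left; left; eauto|auto].
      sets.
    - eapply arcs_swap, arcs_of_missing; [exact PC|exact A|auto| |exact He|auto]; sets.
    - eapply arcs_swap, arcs_of_missing; [exact PC|exact B|auto| |exact He|auto]; sets.
    - left; left; auto.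
    - left; left; auto.
    - auto. }
  path_ends.
  destruct Hx as [Hx|Hx], Hy as [Hy|Hy].
  - eapply (eimage_mono (ladder e1 e2 EN EM)); [unfold ladder, cup; tauto|].
    eapply (image_ear n1 m1 n2 m2 N EN M EM e1 e2 x y C FC);
      eauto using joins_sym; sets.
  - eapply Across; eauto.
  - eapply (Across y x C); eauto using path_rev. intros w a b; destruct (UC w a b); auto.
  - eapply (image_ear m1 n1 m2 n2 M EM N EN e1 e2 x y C FC); eauto; sets.
Qed.
End Injectivity.

(** * Thin cuts and their crossings *)

Section Cuts.
Context {G : graph}.
Hypothesis H3 : k_connected 3 G.
Implicit Types (x y z u v a b c d s t m n : G) (e g h : edge G) (X : G -> Prop) (S : edge G -> Prop).

(** Every circuit meets [S] in exactly 0 or 2 edges, expressed without counting: never three, never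
    just one. *)
Definition thin S := forall V E, cycle V E ->
  (forall e1 e2 e3, E e1 -> E e2 -> E e3 -> S e1 -> S e2 -> S e3 ->
     e1 <> e2 -> e1 <> e3 -> e2 <> e3 -> False) /\
  (forall e, E e -> S e -> exists e', E e' /\ S e' /\ e' <> e).

Definition cut X S := forall e u v, joins e u v -> (S e <-> ~ (X u <-> X v)).

Lemma cut_crossing X S x y V E :
  cut X S -> path x y V E -> ~ (X x <-> X y) -> exists e, E e /\ S e.
Proof.
  intros HC P N.
  destruct (path_crossing _ _ _ _ (fun v => X v <-> X x) P) as (e & u & v & He & J & Hu & Hv);
    try tauto.
  exists e; split; auto; apply (HC _ _ _ J); tauto.
Qed.

Lemma uncut_path X S x y V E v :
  cut X S -> path x y V E -> (forall e, E e -> ~ S e) -> V v -> (X v <-> X x).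
Proof.
  intros HC P N Hv; apply NNPP; intro F.
  destruct (path_split _ _ _ _ _ P Hv) as (V1 & E1 & V2 & E2 & P1 & _ & -> & -> & _).
  destruct (cut_crossing X S _ _ _ _ HC P1) as [e [He Se]]; [tauto|].
  apply (N e); unfold cup; auto.
Qed.

(** Otherwise Menger gives two paths from [b] to the part of the cycle across the cut, disjoint
    except at [b]. Each crosses [S], and with the arc of the cycle that contains [e0] they form a
    circuit with three edges of [S]. *)
Lemma side_separator X S V E e0 b :
  cut X S -> thin S -> cycle V E -> E e0 -> S e0 -> ~ V b ->
  exists s, s <> b /\ forall w VP EP, path b w VP EP -> V w -> ~ (X w <-> X b) ->
    (forall v, VP v -> V v -> v = w) -> VP s.
Proof.
  intros HC HT Cyc E0 S0 Nb; apply NNPP; intro F.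
  set (W := fun v => V v /\ ~ (X v <-> X b)).
  (* Menger runs without [b], from its neighbours to [W]; admitting only those cycle vertices that
     lie in [W] makes each path end at its first contact with the cycle. *)
  set (K := fun v => v <> b /\ (V v -> W v)).
  assert (Sep : forall z, exists n w, (exists e, joins e b n) /\ W w /\
            conn (fun v => K v /\ v <> z) all_edges n w).
  { intro z.
    (* The assumption concerns vertices other than [b] only. For [z = b] any other [s] serves, since
       [K] omits [b] anyway. *)
    assert (exists s, s <> b /\ (z = s \/ z = b)) as [s [Ns Zs]].
    { destruct (classic (z = b)) as [->|]; [|exists z; auto].
      destruct (another_vertex H3 b b b) as [s [? _]]; exists s; auto. }
    assert (exists w VP EP, path b w VP EP /\ V w /\ ~ (X w <-> X b) /\
              (forall v, VP v -> V v -> v = w) /\ ~ VP s)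
      as (w & VP & EP & [k P] & Vw & Xw & U & Nst).
    { apply NNPP; intro Q; apply F; exists s; split; auto.
      intros w VP EP P Vw Xw U; apply NNPP; intro Ns'; apply Q.
      exists w, VP, EP; auto. }
    destruct P as [|k b n w V' E' g J P Nb']; [tauto|].
    exists n, w; repeat split; eauto.
    exists V', E'; repeat split; try (exists k; exact P).
    - intros ->; auto.
    - auto.
    - rewrite (U v); auto; right; auto.
    - intros ->; destruct Zs as [->| ->]; [apply Nst; right; auto|auto]. }
  destruct (two_disjoint_paths K _ W b Sep) as
    (a1 & w1 & a2 & w2 & V1 & E1 & V2 & E2 & [g1 J1] & [Vw1 Xw1] & [g2 J2] & [Vw2 Xw2] &
     P1 & P2 & K1 & K2 & U1 & U2 & D12).
  assert (Nb1 : ~ V1 b) by (intro Q; destruct (K1 b Q); tauto).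
  assert (Nb2 : ~ V2 b) by (intro Q; destruct (K2 b Q); tauto).
  assert (R1 := path_cons _ _ _ _ _ _ J1 P1 Nb1).
  assert (R2 := path_cons _ _ _ _ _ _ J2 P2 Nb2).
  assert (D : forall v, cup (eq b) V1 v -> cup (eq b) V2 v -> v = b).
  { intros v [<-|A] [B|B]; auto; exfalso; eauto. }
  assert (R := path_app _ _ _ _ _ _ _ (path_rev _ _ _ _ R1) R2 D).
  assert (U : forall v, V v -> cup (cup (eq b) V1) (cup (eq b) V2) v -> v = w1 \/ v = w2).
  { intros v Hv [[<-|A]|[<-|A]]; try tauto.
    - left; apply U1; auto; apply K1; auto.
    - right; apply U2; auto; apply K2; auto. }
  assert (Nw : w1 <> w2) by (intros ->; path_ends; eauto).
  destruct (cut_crossing X S _ _ _ _ HC R1) as [h1 [Hh1 S1]]; [tauto|].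
  destruct (cut_crossing X S _ _ _ _ HC R2) as [h2 [Hh2 S2]]; [tauto|].
  assert (N12 : h1 <> h2).
  { intros ->; exact (path_edges_disjoint _ _ _ _ _ _ _ _ _ _ R1 R2 D Hh1 Hh2). }
  destruct (cycle_arcs _ _ _ _ Cyc Vw1 Vw2 Nw) as (Z1 & F1 & Z2 & F2 & A & -> & ->).
  assert (Bad : forall Z F, path w1 w2 Z F -> (forall v, Z v -> cup Z1 Z2 v) -> F e0 -> False).
  { intros Z F' PZ ZV F0.
    assert (AR : arcs w1 w2 Z F' (cup (cup (eq b) V1) (cup (eq b) V2))
                   (cup (cup (eq g1) E1) (cup (eq g2) E2))).
    { apply arcs_swap, (arcs_of_missing w1 w2 _ _ _ _ g1 R PZ Nw).
      - intros v B C; apply U; auto.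
      - left; left; auto.
      - intro Q; apply Nb, ZV; eapply path_edge; eauto.
        apply (joins_in _ _ _ _ J1); auto. }
    assert (L1 : cup (cup (eq g1) E1) (cup (eq g2) E2) h1) by (left; auto).
    assert (L2 : cup (cup (eq g1) E1) (cup (eq g2) E2) h2) by (right; auto).
    apply (proj1 (HT _ _ (cycle_of_arcs _ _ _ _ _ _ AR)) e0 h1 h2); auto.
    - left; auto.
    - right; auto.
    - right; auto.
    - intros ->; exact (arcs_disjoint _ _ _ _ _ _ _ AR F0 L1).
    - intros ->; exact (arcs_disjoint _ _ _ _ _ _ _ AR F0 L2). }
  destruct A as (A1 & A2 & _).
  destruct E0 as [E0|E0]; [apply (Bad Z1 F1)|apply (Bad Z2 F2)]; unfold cup; auto.
Qed.

(** If the quadrant of [b] is missed, the two cuts yield separators [s] and [t]. A path from [b] to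
    the cycle avoiding both first meets it in some [w] across one of the cuts, hence contains [s] or
    [t] after all. *)
Lemma cycle_meets_quadrants X1 S1 X2 S2 V E g1 g2 b :
  cut X1 S1 -> thin S1 -> cut X2 S2 -> thin S2 -> cycle V E ->
  E g1 -> S1 g1 -> E g2 -> S2 g2 ->
  exists v, V v /\ (X1 v <-> X1 b) /\ (X2 v <-> X2 b).
Proof.
  intros C1 T1 C2 T2 Cyc E1 I1 E2 I2; apply NNPP; intro F.
  assert (Nb : ~ V b) by (intro; apply F; exists b; tauto).
  destruct (side_separator X1 S1 V E g1 b) as [s [Ns Hs]]; auto.
  destruct (side_separator X2 S2 V E g2 b) as [t [Nt Ht]]; auto.
  assert (exists v, V v /\ v <> s /\ v <> t) as (v & Vv & Vs & Vt).
  (* The cycle contains two distinct edges, so its vertices are not just [s] and [t]. *)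
  { apply NNPP; intro Q; destruct (proj2 (T1 _ _ Cyc) g1 E1 I1) as [g [Eg [_ N]]].
    assert (W : forall v, V v -> v = s \/ v = t).
    { intros v Vv; apply NNPP; intro; apply Q; exists v; tauto. }
    apply N, (edge_eq_of_ends _ _ s t); intros v Hv; apply W;
      (eapply (cycle_edge _ _ _ _ Cyc); [|exact Hv]); auto. }
  destruct (conn_avoiding H3 s t b v) as (VP & EP & P & K & _); auto.
  destruct (path_first _ _ _ _ V P) as (w & VP' & EP' & P' & Vw & U & Sub & _).
  { exists v; split; auto; eapply path_end; eauto. }
  destruct (classic (X1 w <-> X1 b)) as [Y1|Y1].
  - destruct (classic (X2 w <-> X2 b)) as [Y2|Y2]; [apply F; exists w; auto|].
    apply (proj2 (K t (Sub t (Ht w VP' EP' P' Vw Y2 U)))); auto.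
  - apply (proj1 (K s (Sub s (Hs w VP' EP' P' Vw Y1 U)))); auto.
Qed.

(** The last clause keeps each side connected when [S] is deleted, which is what makes the cut a
    bond. *)
Definition thin_bond X S := cut X S /\ thin S /\
  forall u v, (X u <-> X v) -> conn (fun _ => True) (fun e => ~ S e) u v.

(* The quantification over propositions says that all four quadrants are nonempty. *)
Definition crossing X1 X2 := forall P Q : Prop, exists v, (X1 v <-> P) /\ (X2 v <-> Q).

Lemma path_recrossing X S x y V E v :
  cut X S -> path x y V E -> V v -> ~ (X v <-> X x) -> (X x <-> X y) ->
  exists g h, E g /\ E h /\ S g /\ S h /\ g <> h.
Proof.
  intros HC P Hv N Hxy.
  destruct (path_split _ _ _ _ _ P Hv) as (V1 & E1 & V2 & E2 & P1 & P2 & -> & -> & D).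
  destruct (cut_crossing X S _ _ _ _ HC P1) as [g [Hg Sg]]; [tauto|].
  destruct (cut_crossing X S _ _ _ _ HC P2) as [h [Hh Sh]]; [tauto|].
  exists g, h; unfold cup; repeat split; auto.
  intros ->; exact (path_edges_disjoint _ _ _ _ _ _ _ _ _ _ P1 P2 D Hg Hh).
Qed.

(** The ends [a] and [b] of such an edge lie in opposite quadrants. A bypass of [e] closes to a
    circuit that meets all quadrants, so it visits some [c] and [d] in the other two. In the order
    [a], [d], [c], [b] it changes sides of [X1] three times; in the order [a], [c], [d], [b], of
    [X2]. *)
Lemma no_double_crossing X1 S1 X2 S2 e :
  thin_bond X1 S1 -> thin_bond X2 S2 -> crossing X1 X2 -> S1 e -> S2 e -> False.
Proof.
  intros (C1 & T1 & _) (C2 & T2 & _) Quad I1 I2.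
  destruct (joins_exists e) as [a [b J]].
  destruct (edge_bypass H3 _ _ _ J) as (V & E & P & Ne).
  assert (Nab := joins_neq _ _ _ J).
  assert (A := proj1 (C1 _ _ _ J) I1); assert (B := proj1 (C2 _ _ _ J) I2).
  assert (AR : arcs a b V E (upair a b) (eq e)).
  { apply arcs_swap, (arcs_of_missing a b _ _ _ _ e); auto using path_single. }
  assert (Cyc := cycle_of_arcs _ _ _ _ _ _ AR).
  assert (Meet : forall P Q : Prop, exists v, V v /\ (X1 v <-> P) /\ (X2 v <-> Q)).
  { intros P' Q; destruct (Quad P' Q) as [q [Q1 Q2]].
    destruct (cycle_meets_quadrants X1 S1 X2 S2 _ _ e e q C1 T1 C2 T2 Cyc)
      as (v & Vv & V1 & V2); auto; try (right; auto; fail).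
    exists v; repeat split; try tauto.
    path_ends; destruct Vv as [Vv|[Vv|Vv]]; subst; auto. }
  destruct (Meet (X1 a) (~ X2 a)) as (c & Vc & Hc1 & Hc2).
  destruct (Meet (~ X1 a) (X2 a)) as (d & Vd & Hd1 & Hd2).
  assert (Na1 : ~ (X1 a <-> X1 d)) by (clear - Hd1; tauto).
  assert (Nb1 : ~ (X1 d <-> X1 c)) by (clear - Hc1 Hd1; tauto).
  assert (Nc1 : ~ (X1 c <-> X1 b)) by (clear - Hc1 A; tauto).
  assert (Na2 : ~ (X2 a <-> X2 c)) by (clear - Hc2; tauto).
  assert (Nb2 : ~ (X2 c <-> X2 d)) by (clear - Hc2 Hd2; tauto).
  assert (Nc2 : ~ (X2 d <-> X2 b)) by (clear - Hd2 B; tauto).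
  assert (Three : forall X S x y V1 E1 V2 E2 V3 E3, cut X S -> thin S ->
    path a x V1 E1 -> path x y V2 E2 -> path y b V3 E3 ->
    (forall e, E1 e -> E e) -> (forall e, E2 e -> E e) -> (forall e, E3 e -> E e) ->
    (forall v, V1 v -> V2 v -> v = x) -> (forall v, V2 v -> V3 v -> v = y) ->
    (forall v, V1 v -> V3 v -> v = y) ->
    ~ (X a <-> X x) -> ~ (X x <-> X y) -> ~ (X y <-> X b) -> False).
  { intros X S x y V1 E1 V2 E2 V3 E3 HC HT P1 P2 P3 K1 K2 K3 D12 D23 D13 N1 N2 N3.
    destruct (cut_crossing X S _ _ _ _ HC P1 N1) as [g1 [Hg1 Sg1]].
    destruct (cut_crossing X S _ _ _ _ HC P2 N2) as [g2 [Hg2 Sg2]].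
    destruct (cut_crossing X S _ _ _ _ HC P3 N3) as [g3 [Hg3 Sg3]].
    apply (proj1 (HT _ _ Cyc) g1 g2 g3); auto; try (left; auto); intros ->.
    - exact (path_edges_disjoint _ _ _ _ _ _ _ _ _ _ P1 P2 D12 Hg1 Hg2).
    - exact (path_edges_disjoint _ _ _ _ _ _ _ _ _ _ P1 P3 D13 Hg1 Hg3).
    - exact (path_edges_disjoint _ _ _ _ _ _ _ _ _ _ P2 P3 D23 Hg2 Hg3). }
  destruct (path_split _ _ _ _ _ P Vc) as (Va & Ea & Vb & Eb & Pa & Pb & -> & -> & D).
  destruct Vd as [Vd|Vd].
  - destruct (path_split _ _ _ _ _ Pa Vd) as (Vp & Ep & Vq & Eq & Pp & Pq & -> & -> & D').
    eapply (Three X1 S1 d c Vp Ep Vq Eq Vb Eb); unfold cup; auto;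
      intros v A' B'; apply D; unfold cup; auto.
  - destruct (path_split _ _ _ _ _ Pb Vd) as (Vp & Ep & Vq & Eq & Pp & Pq & -> & -> & D').
    eapply (Three X2 S2 c d Va Ea Vp Ep Vq Eq); unfold cup; auto;
      intros v A' B'; assert (v = c) by (apply D; unfold cup; auto); subst v; auto.
    apply D'; auto; eapply path_start; eauto.
Qed.

(** Take a circuit through [x] and [y] and suppose that both arcs leave the quadrant. An arc that
    crosses a bond does so twice, so the arcs cannot cross the same one. If they cross different
    bonds, the circuit still visits the opposite quadrant, and the arc doing so crosses both. *)
Lemma quadrant_connected X1 S1 X2 S2 x y :
  thin_bond X1 S1 -> thin_bond X2 S2 -> crossing X1 X2 ->
  (X1 y <-> X1 x) -> (X2 y <-> X2 x) ->
  conn (fun v => (X1 v <-> X1 x) /\ (X2 v <-> X2 x)) all_edges x y.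
Proof.
  intros (C1 & T1 & _) (C2 & T2 & _) Quad Y1 Y2.
  destruct (classic (x = y)) as [->|Nxy]; [apply conn_refl; tauto|].
  (* A circuit through two vertices is obtained from one through distinct edges at them. *)
  destruct (third_neighbour H3 x y y Nxy Nxy) as (e & x' & Je & _).
  destruct (third_neighbour H3 y x x (not_eq_sym Nxy) (not_eq_sym Nxy)) as (g & y' & Jg & Ny' & _).
  assert (Neg : e <> g).
  { intros ->; destruct (joins_ends _ _ _ _ _ Je Jg) as [[? ?]|[? ?]]; subst; tauto. }
  destruct (cycle_through_edges (fun _ => True) e g Neg (fun _ _ => I) (fun _ _ => I)
              (edges_not_separated H3 e g))
    as (m1 & n1 & m2 & n2 & M & EM & N & EN & J1 & J2 & PM & PN & _ & _ & D).
  assert (Cyc := ladder_cycle _ _ _ _ _ _ _ _ _ _ Neg J1 J2 PM PN D).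
  path_ends.
  assert (Vx : cup M N x).
  { destruct (joins_ends _ _ _ _ _ Je J1) as [[? ?]|[? ?]]; subst; unfold cup; auto. }
  assert (Vy : cup M N y).
  { destruct (joins_ends _ _ _ _ _ Jg J2) as [[? ?]|[? ?]]; subst; unfold cup; auto. }
  destruct (cycle_arcs _ _ _ _ Cyc Vx Vy Nxy) as (P1 & F1 & P2 & F2 & A & HV & HE).
  rewrite HV, HE in Cyc.
  assert (Dis := fun e => arcs_disjoint _ _ _ _ _ _ e A).
  destruct A as (A1 & A2 & _).
  apply NNPP; intro NC.
  assert (Out : forall P F, path x y P F ->
    exists v, P v /\ (~ (X1 v <-> X1 x) \/ ~ (X2 v <-> X2 x))).
  { intros P F HP; apply NNPP; intro Q; apply NC; exists P, F; split; [auto|split].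
    - intros v Hv; apply NNPP; intro; apply Q; exists v; tauto.
    - intros; exact I. }
  assert (Excl : forall X S u v, cut X S -> thin S -> (X x <-> X y) -> P1 u -> P2 v ->
    ~ (X u <-> X x) -> ~ (X v <-> X x) -> False).
  { intros X S u v HC HT Hxy Pu Pv Nu Nv.
    destruct (path_recrossing X S _ _ _ _ u HC A1) as (g1 & h1 & K1 & L1 & M1 & N1 & O1); auto.
    destruct (path_recrossing X S _ _ _ _ v HC A2) as (g2 & h2 & K2 & L2 & M2 & N2 & O2); auto.
    apply (proj1 (HT _ _ Cyc) g1 h1 g2); unfold cup; auto; intros ->;
      [exact (Dis _ K1 K2)|exact (Dis _ L1 K2)]. }
  assert (Both : forall X S Y T u v, cut X S -> thin S -> cut Y T -> thin T ->
    (X x <-> X y) -> (Y x <-> Y y) -> crossing X Y -> P1 u -> P2 v ->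
    ~ (X u <-> X x) -> ~ (Y v <-> Y x) -> False).
  { intros X S Y T u v HC HT HC' HT' Hxy Hxy' Cr Pu Pv Nu Nv.
    destruct (path_recrossing X S _ _ _ _ u HC A1) as (g1 & h1 & K1 & L1 & M1 & N1 & O1); auto.
    destruct (path_recrossing Y T _ _ _ _ v HC' A2) as (g2 & h2 & K2 & L2 & M2 & N2 & O2); auto.
    destruct (Cr (~ X x) (~ Y x)) as [q [Q1 Q2]].
    destruct (cycle_meets_quadrants X S Y T _ _ g1 g2 q HC HT HC' HT' Cyc)
      as (o & [Vo|Vo] & O3 & O4); unfold cup; auto.
    - apply (Excl Y T o v); auto; tauto.
    - apply (Excl X S u o); auto; tauto. }
  destruct (Out _ _ A1) as (u & Pu & Nu), (Out _ _ A2) as (v & Pv & Nv).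
  assert (Cr : crossing X2 X1).
  { intros P Q; destruct (Quad Q P) as [q [? ?]]; exists q; auto. }
  destruct Nu as [Nu|Nu], Nv as [Nv|Nv].
  - apply (Excl X1 S1 u v); auto; tauto.
  - apply (Both X1 S1 X2 S2 u v); auto; tauto.
  - apply (Both X2 S2 X1 S1 u v); auto; tauto.
  - apply (Excl X2 S2 u v); auto; tauto.
Qed.

(** The side of [X1] selected by [P] is connected without [S1], so some edge of [S2] joins its two
    quadrants. This gives the ring arrangement. *)
Lemma gap_edge X1 S1 X2 S2 (P : Prop) :
  thin_bond X1 S1 -> thin_bond X2 S2 -> crossing X1 X2 ->
  exists e u v, joins e u v /\ S2 e /\ (X1 u <-> P) /\ (X1 v <-> P) /\ X2 u /\ ~ X2 v.
Proof.
  intros (C1 & _ & U1) (C2 & _) Quad.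
  destruct (Quad P True) as [x [Hx1 Hx2]], (Quad P False) as [y [Hy1 Hy2]].
  destruct (U1 x y) as (V & E & HP & _ & HE); [tauto|].
  destruct (path_crossing _ _ _ _ X2 HP) as (e & u & v & He & J & Hu & Hv); try tauto.
  assert (K : forall w, V w -> (X1 w <-> X1 x)) by (intros; eapply uncut_path; eauto).
  assert (V u) by (eapply path_edge; eauto; apply (joins_in _ _ _ _ J); auto).
  assert (V v) by (eapply path_edge; eauto; apply (joins_in _ _ _ _ J); auto).
  assert (Ku := K u ltac:(auto)); assert (Kv := K v ltac:(auto)).
  exists e, u, v; split; [auto|split; [apply (C2 _ _ _ J); tauto|tauto]].
Qed.

(** The edge [g] enters the quadrant inside [X1] and outside [X2] from one neighbouring quadrant,
    and [h] leaves it to the other. Without a vertex separating them in [K], a circuit through [g]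
    and [h] would miss the fourth quadrant. *)
Lemma quadrant_separator X1 S1 X2 S2 :
  thin_bond X1 S1 -> thin_bond X2 S2 -> crossing X1 X2 ->
  exists s, X1 s /\ ~ X2 s /\ forall a b, X1 a -> X2 a -> ~ X1 b -> ~ X2 b ->
    ~ conn (fun v => ~ (~ X1 v /\ X2 v) /\ v <> s) all_edges a b.
Proof.
  intros B1 B2 Cr.
  assert (Cr' : crossing X2 X1).
  { intros P Q; destruct (Cr Q P) as [q [? ?]]; exists q; auto. }
  destruct (gap_edge X1 S1 X2 S2 True B1 B2 Cr) as (g & a1 & c1 & Jg & Sg & G1 & G2 & G3 & G4).
  destruct (gap_edge X2 S2 X1 S1 False B2 B1 Cr') as (h & c2 & b2 & Jh & Sh & H1 & H2 & H4 & H5).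
  set (K := fun v => ~ (~ X1 v /\ X2 v)).
  assert (Kg : forall v, proj1_sig g v -> K v).
  { intros v Hv; destruct (proj1 (joins_in _ _ _ _ Jg) Hv); subst; unfold K; tauto. }
  assert (Kh : forall v, proj1_sig h v -> K v).
  { intros v Hv; destruct (proj1 (joins_in _ _ _ _ Jh) Hv); subst; unfold K; tauto. }
  assert (Neg : g <> h).
  { intros ->; exact (no_double_crossing X1 S1 X2 S2 h B1 B2 Cr Sh Sg). }
  assert (exists s, forall a b, proj1_sig g a -> proj1_sig h b ->
            ~ conn (fun v => K v /\ v <> s) all_edges a b) as [s Hs].
  { apply NNPP; intro F.
    destruct (cycle_through_edges K g h Neg Kg Kh)
      as (m1 & n1 & m2 & n2 & M & EM & N & EN & J1 & J2 & PM & PN & KM & KN & D).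
    { intro z; apply NNPP; intro Q; apply F; exists z; intros a b Ha Hb C; apply Q; eauto. }
    assert (Cyc := ladder_cycle _ _ _ _ _ _ _ _ _ _ Neg J1 J2 PM PN D).
    destruct (Cr False True) as [d [D1 D2]].
    destruct (cycle_meets_quadrants X1 S1 X2 S2 _ _ h g d
                (proj1 B1) (proj1 (proj2 B1)) (proj1 B2) (proj1 (proj2 B2)) Cyc)
      as (v & [Vv|Vv] & V1 & V2); auto.
    - right; right; right; auto.
    - right; left; auto.
    - apply KM in Vv; unfold K in Vv; tauto.
    - apply KN in Vv; unfold K in Vv; tauto. }
  assert (InG : proj1_sig g a1 /\ proj1_sig g c1) by (split; apply (joins_in _ _ _ _ Jg); auto).
  assert (InH : proj1_sig h c2 /\ proj1_sig h b2) by (split; apply (joins_in _ _ _ _ Jh); auto).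
  assert (Link : forall x y, (X1 y <-> X1 x) -> (X2 y <-> X2 x) -> K x ->
            ~ ((X1 s <-> X1 x) /\ (X2 s <-> X2 x)) ->
            conn (fun v => K v /\ v <> s) all_edges x y).
  { intros x y Y1 Y2 Kx Ns.
    eapply conn_mono; [| |apply (quadrant_connected X1 S1 X2 S2 x y B1 B2 Cr Y1 Y2)]; auto.
    intros v [W1 W2]; split; [unfold K in *; tauto|intros ->; tauto]. }
  (* Both edges have an end in this connected quadrant, so a separator must lie in it; then the
     other two quadrants in [K] stay connected without [s]. *)
  assert (Cs : X1 s /\ ~ X2 s).
  { apply NNPP; intro Ns; apply (Hs c1 c2); try tauto.
    apply Link; unfold K; tauto. }
  exists s; split; [tauto|split; [tauto|]].
  intros a b A1 A2 N1 N2 C; apply (Hs a1 b2); try tauto.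
  apply (conn_trans _ _ _ a); [apply Link; unfold K; tauto|].
  apply (conn_trans _ _ _ b); [exact C|apply Link; unfold K; tauto].
Qed.

(** One vertex blocks each of the two ways round the ring between opposite quadrants, so [s] and [t]
    together separate [a] from [b]. *)
Lemma thin_bonds_not_crossing X1 S1 X2 S2 :
  thin_bond X1 S1 -> thin_bond X2 S2 -> ~ crossing X1 X2.
Proof.
  intros B1 B2 Cr.
  assert (Cr' : crossing X2 X1).
  { intros P Q; destruct (Cr Q P) as [q [? ?]]; exists q; auto. }
  destruct (quadrant_separator X1 S1 X2 S2 B1 B2 Cr) as (s & Ss1 & Ss2 & Hs).
  destruct (quadrant_separator X2 S2 X1 S1 B2 B1 Cr') as (t & St2 & St1 & Ht).
  destruct (Cr True True) as [a [A1 A2]], (Cr False False) as [b [N1 N2]].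
  assert (NotS : forall v, X2 v -> v <> s) by (intros v ? ->; tauto).
  assert (NotT : forall v, X1 v -> v <> t) by (intros v ? ->; tauto).
  set (L := fun v => ~ (~ X1 v /\ X2 v) /\ v <> s).
  set (R := fun v => ~ (~ X2 v /\ X1 v) /\ v <> t).
  (* All that can be reached from the quadrant of [a] without [s] and [t], before the opposite
     quadrant. No edge joins opposite quadrants, so a path avoiding [s] and [t] cannot leave [T]. *)
  set (T := fun v => (X1 v /\ X2 v) \/ (X1 v /\ ~ X2 v /\ conn L all_edges a v) \/
                     (~ X1 v /\ X2 v /\ conn R all_edges a v)).
  assert (NsB : forall v, ~ X1 v -> v <> s) by (intros v ? ->; tauto).
  assert (NtB : forall v, ~ X2 v -> v <> t) by (intros v ? ->; tauto).
  destruct (conn_avoiding H3 s t a b) as (V & E & P & KV & _); auto; try (apply NotS; tauto);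
    try (apply NotT; tauto); try (apply NsB; tauto); try (apply NtB; tauto).
  destruct (path_crossing _ _ _ _ T P) as (e & u & v & He & J & Tu & Tv).
  - unfold T; tauto.
  - unfold T; tauto.
  - assert (NC : ~ (~ (X1 u <-> X1 v) /\ ~ (X2 u <-> X2 v))).
    { intros [D1 D2]; apply (no_double_crossing X1 S1 X2 S2 e B1 B2 Cr).
      - apply (proj1 B1 _ _ _ J); auto.
      - apply (proj1 B2 _ _ _ J); auto. }
    destruct (KV v) as [Vs Vt]; [eapply path_edge; eauto; apply (joins_in _ _ _ _ J); auto|].
    destruct (KV u) as [Us Ut]; [eapply path_edge; eauto; apply (joins_in _ _ _ _ J); auto|].
    assert (Au : X1 u -> X2 u -> conn L all_edges a u /\ conn R all_edges a u).
    { intros U1 U2.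
      assert (Q : conn (fun v => (X1 v <-> X1 a) /\ (X2 v <-> X2 a)) all_edges a u)
        by (apply (quadrant_connected X1 S1 X2 S2); auto; tauto).
      split; (eapply conn_mono; [| |exact Q]; auto); intros w [W1 W2]; unfold L, R;
        split; try tauto; [apply NotS|apply NotT]; tauto. }
    assert (SL : conn L all_edges a u -> L u -> L v -> conn L all_edges a v).
    { intros C Lu Lv; apply (conn_trans _ _ _ u); auto.
      apply (conn_edge _ _ e); auto; exact I. }
    assert (SR : conn R all_edges a u -> R u -> R v -> conn R all_edges a v).
    { intros C Ru Rv; apply (conn_trans _ _ _ u); auto.
      apply (conn_edge _ _ e); auto; exact I. }
    assert (NL : ~ X1 v -> ~ X2 v -> ~ conn L all_edges a v)
      by (intros ? ?; apply Hs; tauto).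
    assert (NR : ~ X1 v -> ~ X2 v -> ~ conn R all_edges a v)
      by (intros ? ?; apply Ht; tauto).
    assert (Lu : ~ (~ X1 u /\ X2 u) -> L u) by (split; auto).
    assert (Lv : ~ (~ X1 v /\ X2 v) -> L v) by (split; auto).
    assert (Ru : ~ (~ X2 u /\ X1 u) -> R u) by (split; auto).
    assert (Rv : ~ (~ X2 v /\ X1 v) -> R v) by (split; auto).
    assert (TvL : X1 v -> conn L all_edges a v -> T v)
      by (intros; destruct (classic (X2 v)); [left|right; left]; auto).
    assert (TvR : X2 v -> conn R all_edges a v -> T v)
      by (intros; destruct (classic (X1 v)); [left|right; right]; auto).
    destruct (classic (X1 v)) as [V1|V1], (classic (X2 v)) as [V2|V2].
    + apply Tv; left; auto.
    + apply Tv, TvL; auto. apply SL; [| |apply Lv; intros [? ?]; auto].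
      * destruct Tu as [[U1 U2]|[(U1 & U2 & U3)|(U1 & U2 & U3)]];
          [apply Au; auto|auto|exfalso; apply NC; split; intros [? ?]; auto].
      * apply Lu; intros [? ?]; apply NC; split; intros [? ?]; auto.
    + apply Tv, TvR; auto. apply SR; [| |apply Rv; intros [? ?]; auto].
      * destruct Tu as [[U1 U2]|[(U1 & U2 & U3)|(U1 & U2 & U3)]];
          [apply Au; auto|exfalso; apply NC; split; intros [? ?]; auto|auto].
      * apply Ru; intros [? ?]; apply NC; split; intros [? ?]; auto.
    + destruct Tu as [[U1 U2]|[(U1 & U2 & U3)|(U1 & U2 & U3)]].
      * apply NC; split; intros [? ?]; auto.
      * apply NL; auto. apply SL; auto; [apply Lu|apply Lv]; intros [? ?]; auto.
      * apply NR; auto. apply SR; auto; [apply Ru|apply Rv]; intros [? ?]; auto.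
Qed.

End Cuts.

(** * Thin edge sets are bonds *)

Section Bonds.
Context {G : graph}.
Hypothesis H3 : k_connected 3 G.
Implicit Types (x y z u v a b c d s t m n : G) (e g h : edge G) (X : G -> Prop) (S : edge G -> Prop).

Definition free S x y := conn (fun _ => True) (fun e => ~ S e) x y.

(** A path between the ends avoiding [S] would close with [e] to a circuit with exactly one edge of
    [S]. *)
Lemma thin_edge_separates S e u v : thin S -> joins e u v -> S e -> ~ free S u v.
Proof.
  intros HT J He (V & E & P & _ & HE).
  assert (A : arcs u v (upair u v) (eq e) V E).
  { apply (arcs_of_missing u v _ _ _ _ e); auto using path_single.
    - eapply joins_neq; eauto.
    - intro F; exact (HE e F He). }
  destruct (proj2 (HT _ _ (cycle_of_arcs _ _ _ _ _ _ A)) e) as (g & [Hg|Hg] & Sg & N);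
    [left| | |]; auto.
  exact (HE g Hg Sg).
Qed.

(** A circuit through [e0] and an edge at [z] offers two routes from [z] to the ends of [e0]. If
    both met [S], the circuit would have three edges of [S]. *)
Lemma thin_free_end S e0 x0 y0 z : thin S -> joins e0 x0 y0 -> S e0 -> free S x0 z \/ free S y0 z.
Proof.
  intros HT J0 S0.
  destruct (classic (z = x0)) as [->|Nx]; [left; apply conn_refl; exact I|].
  destruct (classic (z = y0)) as [->|Ny]; [right; apply conn_refl; exact I|].
  destruct (third_neighbour H3 z x0 x0 Nx Nx) as (g & z' & J & _).
  assert (Neg : e0 <> g).
  { intros ->; destruct (joins_ends _ _ _ _ _ J0 J) as [[? ?]|[? ?]]; subst; tauto. }
  destruct (cycle_through_edges (fun _ => True) e0 g Neg (fun _ _ => I) (fun _ _ => I)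
              (edges_not_separated H3 e0 g))
    as (m1 & n1 & m2 & n2 & M & EM & N & EN & J1 & J2 & PM & PN & _ & _ & D).
  assert (Side : forall m1 n1 m2 n2 M EM N EN, joins e0 m1 n1 -> joins g m2 n2 ->
    path m1 m2 M EM -> path n1 n2 N EN -> (forall v, M v -> N v -> False) ->
    free S m1 m2 \/ free S n1 m2).
  { clear m1 n1 m2 n2 M EM N EN J1 J2 PM PN D.
    intros m1 n1 m2 n2 M EM N EN J1 J2 PM PN D.
    assert (Cyc := ladder_cycle _ _ _ _ _ _ _ _ _ _ Neg J1 J2 PM PN D).
    destruct (classic (exists h, EM h /\ S h)) as [[h1 [H1 S1]]|F1].
    2:{ left; exists M, EM; repeat split; auto. intros h H1 S1; apply F1; eauto. }
    destruct (classic (exists h, (g = h \/ EN h) /\ S h)) as [[h2 [H2 S2]]|F2].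
    - exfalso; path_ends.
      assert (EMV : forall h v, EM h -> proj1_sig h v -> N v -> False)
        by (intros h v A B C; apply (D v); auto; eapply path_edge; eauto).
      assert (ENV : forall h v, EN h -> proj1_sig h v -> M v -> False)
        by (intros h v A B C; apply (D v); auto; eapply path_edge; eauto).
      apply (proj1 (HT _ _ Cyc) e0 h1 h2); auto.
      + right; left; auto.
      + left; auto.
      + right; right; destruct H2; [right|left]; auto.
      + intros ->; apply (EMV h1 n1); auto; apply (joins_in _ _ _ _ J1); auto.
      + intros ->; destruct H2 as [H2|H2]; [congruence|].
        apply (ENV h2 m1); auto; apply (joins_in _ _ _ _ J1); auto.
      + intros ->; destruct H2 as [<-|H2].
        * apply (EMV g n2); auto; apply (joins_in _ _ _ _ J2); auto.
        * destruct (joins_exists h2) as [u [v Jh]].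
          apply (EMV h2 u); auto; [apply (joins_in _ _ _ _ Jh); auto|].
          eapply path_edge; eauto; apply (joins_in _ _ _ _ Jh); auto.
    - right; apply (conn_trans _ _ _ n2).
      + exists N, EN; repeat split; auto. intros h H2 S2; apply F2; eauto.
      + apply (conn_edge _ _ g); auto using joins_sym. intro Sg; apply F2; eauto. }
  assert (K : free S m1 z \/ free S n1 z).
  { destruct (joins_ends _ _ _ _ _ J J2) as [[-> _]|[-> _]].
    - eapply Side; eauto.
    - apply or_comm, (Side n1 m1 n2 m2 N EN M EM); auto using joins_sym.
      intros v A B; eauto. }
  destruct (joins_ends _ _ _ _ _ J0 J1) as [[-> ->]|[-> ->]]; tauto.
Qed.

(** By [thin_free_end], deleting [S] leaves only the components of [x0] and [y0]; by
    [thin_edge_separates], every edge of [S] runs between them. *)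
Lemma thin_is_bond S e0 x0 y0 : thin S -> joins e0 x0 y0 -> S e0 -> thin_bond (free S x0) S.
Proof.
  intros HT J0 S0.
  assert (Other : forall v, ~ free S x0 v -> free S y0 v).
  { intros v N; destruct (thin_free_end S e0 x0 y0 v HT J0 S0); tauto. }
  assert (Same : forall u v, (free S x0 u <-> free S x0 v) -> free S u v).
  { intros u v H; destruct (classic (free S x0 u)) as [F|F].
    - apply (conn_trans _ _ _ x0); [apply conn_sym; auto|tauto].
    - apply (conn_trans _ _ _ y0); [apply conn_sym|]; apply Other; tauto. }
  split; [|split; auto].
  intros e u v J; split.
  - intros Se H; exact (thin_edge_separates S e u v HT J Se (Same u v H)).
  - intro N; apply NNPP; intro Ns; apply N.
    assert (C : free S u v) by (apply (conn_edge _ _ e); auto; exact I).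
    split; intro F; (eapply conn_trans; [exact F|]); auto; apply conn_sym; auto.
Qed.

(** A side that stays connected without [S] and contains no edge is a single vertex, so the cut is
    its star. *)
Lemma bond_side_star X S x :
  thin_bond X S -> X x ->
  (forall e u v, joins e u v -> X u -> X v -> False) ->
  forall e, S e <-> proj1_sig e x.
Proof.
  intros (HC & HT & Same) Xx NoIn.
  assert (One : forall v, X v -> v = x).
  { intros v Xv; destruct (Same x v) as (V & E & [n P] & _ & HE); [tauto|].
    destruct P as [|n x y v V E e J P N]; auto; exfalso.
    assert (Nse : ~ S e) by (apply HE; left; auto).
    apply (NoIn e x y J Xx); apply NNPP; intro F; apply Nse, (HC _ _ _ J); tauto. }
  intro e; destruct (joins_exists e) as [u [v J]].
  rewrite (HC _ _ _ J), (joins_in _ _ _ _ J).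
  assert (N := joins_neq _ _ _ J).
  assert (U : forall w, X w <-> x = w) by (intro w; split; [symmetry; auto|intros <-; auto]).
  rewrite !U; split.
  - intro H; apply NNPP; tauto.
  - intros [<-|<-] [A B]; [apply N, A|apply N; symmetry; apply B]; auto.
Qed.

Lemma bond_complement X S : thin_bond X S -> thin_bond (fun v => ~ X v) S.
Proof.
  intros (HC & HT & Same); split; [|split; auto].
  - intros e u v J; rewrite (HC _ _ _ J).
    destruct (classic (X u)), (classic (X v)); tauto.
  - intros u v H; apply Same; destruct (classic (X u)), (classic (X v)); tauto.
Qed.

End Bonds.

(** * Preimages of stars *)

Section Stars.
Context {G G' : graph} (f : edge G -> edge G').
Hypothesis H3 : k_connected 3 G.
Hypothesis Iso : no_isolated G'.
Hypothesis Hf : circuit_surjection f.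
Hypothesis Inj : forall e1 e2, f e1 = f e2 -> e1 = e2.
Implicit Types (x y z u v : G) (p q w : G') (e g h : edge G).

Definition pulled_star w e : Prop := proj1_sig (f e) w.

(** The image circuit has degree 0 or 2 at [w], and injectivity of [f] carries the count back. *)
Lemma pulled_star_thin w : thin (pulled_star w).
Proof.
  intros V E Cyc; assert (C := proj2 Hf _ (cycle_circuit _ _ Cyc)).
  assert (In : forall e, E e -> eimage f E (f e)) by (intros e H; exists e; auto).
  split.
  - intros e1 e2 e3 E1 E2 E3 S1 S2 S3 N12 N13 N23.
    destruct (circuit_edges_at _ _ _ C (In _ E1) S1) as (g & h & _ & _ & _ & K).
    apply (K _ (In _ E1)) in S1; apply (K _ (In _ E2)) in S2; apply (K _ (In _ E3)) in S3.
    destruct S1, S2, S3;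
      first [apply N12; apply Inj; congruence|apply N13; apply Inj; congruence
            |apply N23; apply Inj; congruence].
  - intros e He Se.
    destruct (circuit_edges_at _ _ _ C (In _ He) Se) as (g & h & Ngh & [g' [Eg <-]] & [h' [Eh <-]] & K).
    destruct (classic (g' = e)) as [->|N]; [exists h'|exists g']; repeat split; auto.
    + apply K; auto.
    + congruence.
    + apply K; auto.
Qed.

Lemma pulled_star_edge w : exists e x y, joins e x y /\ pulled_star w e.
Proof.
  destruct (Iso w) as [w' A]; destruct (adj_joins _ _ A) as [e' J].
  destruct (proj1 Hf e') as [e <-], (joins_exists e) as [x [y Je]].
  exists e, x, y; split; auto; apply (joins_in _ _ _ _ J); auto.
Qed.

Lemma pulled_star_bond w : exists X, thin_bond X (pulled_star w) /\ (exists x, X x) /\ exists y, ~ X y.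
Proof.
  destruct (pulled_star_edge w) as (e & x & y & J & S).
  exists (free (pulled_star w) x); split; [|split].
  - eapply thin_is_bond; eauto using pulled_star_thin.
  - exists x; apply conn_refl; exact I.
  - exists y; eapply thin_edge_separates; eauto using pulled_star_thin.
Qed.

(** Take a circuit through both edges. In its image without [w], lying inside [X] passes from each
    edge to the next, hence from [e1] to [e2], which is absurd. *)
Lemma pulled_star_one_sided w X e1 u1 v1 e2 u2 v2 :
  thin_bond X (pulled_star w) -> joins e1 u1 v1 -> joins e2 u2 v2 ->
  X u1 -> X v1 -> ~ X u2 -> ~ X v2 -> False.
Proof.
  intros B J1 J2 Xu1 Xv1 Xu2 Xv2; assert (HC := proj1 B).
  assert (Ne : e1 <> e2).
  { intros ->; destruct (joins_ends _ _ _ _ _ J1 J2) as [[? ?]|[? ?]]; subst; tauto. }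
  destruct (cycle_through_edges (fun _ => True) e1 e2 Ne (fun _ _ => I) (fun _ _ => I)
              (edges_not_separated H3 e1 e2))
    as (m1 & n1 & m2 & n2 & M & EM & N & EN & K1 & K2 & PM & PN & _ & _ & D).
  assert (Cyc := ladder_cycle _ _ _ _ _ _ _ _ _ _ Ne K1 K2 PM PN D).
  assert (C := proj2 Hf _ (cycle_circuit _ _ Cyc)).
  set (T := fun k => exists e, f e = k /\ exists u v, joins e u v /\ X u /\ X v).
  (* If [g] is inside [X] and [h] inside the complement while their images meet in [p], the bond of
     [p] splits the ends of both edges. These four ends occupy all four quadrants, so the bonds of
     [w] and [p] cross. *)
  assert (Sep : forall g h p, proj1_sig (f g) p -> proj1_sig (f h) p ->
    ~ proj1_sig (f g) w -> ~ proj1_sig (f h) w -> T (f g) -> T (f h)).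
  { intros g h p Gp Hp Gw Hw [g' [Eg (a & c & J & Xa & Xc)]]; apply Inj in Eg; subst g'.
    apply NNPP; intro NT.
    destruct (joins_exists h) as [d [b J']].
    assert (Same : X d <-> X b).
    { apply NNPP; intro F; apply Hw, (HC _ _ _ J'); auto. }
    assert (Nd : ~ X d) by (intro F; apply NT; exists h; split; auto; exists d, b; tauto).
    destruct (pulled_star_bond p) as (Y & BY & _).
    assert (Ya := proj1 (proj1 BY _ _ _ J) Gp).
    assert (Yd := proj1 (proj1 BY _ _ _ J') Hp).
    apply (thin_bonds_not_crossing H3 _ _ _ _ B BY).
    assert (Pick : forall (Q : Prop) u v, ~ (Y u <-> Y v) -> (Y u <-> Q) \/ (Y v <-> Q)).
    { clear; intros Q u v H; destruct (classic (Y u)), (classic (Y v)), (classic Q); tauto. }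
    intros P Q; destruct (classic P) as [HP|HP].
    - destruct (Pick Q _ _ Ya); [exists a|exists c]; split; auto; split; auto.
    - destruct (Pick Q _ _ Yd); [exists d|exists b]; split; auto; split; intro; tauto. }
  assert (T2 : ~ T (f e2)).
  { intros [e [E (u & v & J & Xu & Xv)]]; apply Inj in E; subst e.
    destruct (joins_ends _ _ _ _ _ J J2) as [[? ?]|[? ?]]; subst; tauto. }
  apply T2; apply (circuit_propagate _ T (fun p => p <> w) C) with (g := f e1).
  - intros p q A A'; apply NNPP in A; apply NNPP in A'; congruence.
  - intros g h p [g' [_ <-]] [h' [_ <-]] _ Hg Hh Og Oh.
    assert (~ proj1_sig (f g') w) by (intro F; exact (Og w F eq_refl)).
    assert (~ proj1_sig (f h') w) by (intro F; exact (Oh w F eq_refl)).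
    split; apply (Sep _ _ p); auto.
  - exists e1; split; auto; right; left; auto.
  - exists e2; split; auto; right; right; right; auto.
  - intros p Hp ->; apply (HC _ _ _ J1) in Hp; tauto.
  - intros p Hp ->; apply (HC _ _ _ J2) in Hp; tauto.
  - exists e1; eauto 6.
Qed.

Definition star_at x w := forall e, pulled_star w e <-> proj1_sig e x.

(** One side of the bond contains no edge, so [bond_side_star] applies to it. *)
Lemma pulled_star_is_star w : exists x, star_at x w.
Proof.
  destruct (pulled_star_bond w) as (X & B & [x Xx] & [y Xy]).
  destruct (classic (exists e u v, joins e u v /\ X u /\ X v)) as [(e & u & v & J & Xu & Xv)|F].
  - exists y; refine (bond_side_star (fun v => ~ X v) _ y (bond_complement _ _ B) Xy _).
    intros g a b Jg Xa Xb; exact (pulled_star_one_sided w X _ _ _ _ _ _ B J Jg Xu Xv Xa Xb).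
  - exists x; refine (bond_side_star X _ x B Xx _).
    intros e u v J Xu Xv; apply F; eauto 6.
Qed.

Lemma two_edges_at x : exists e g y z, joins e x y /\ joins g x z /\ y <> z.
Proof.
  destruct (another_vertex H3 x x x) as [a [Na _]].
  destruct (third_neighbour H3 x a a) as (e & y & J & _); auto.
  assert (N := joins_neq _ _ _ J).
  destruct (third_neighbour H3 x y y N N) as (g & z & Jg & Nz & _).
  exists e, g, y, z; auto.
Qed.

(** For [p] and [q] distinct, every edge at [x] would be mapped to the edge [pq], although two edges
    at [x] have different images. *)
Lemma star_at_functional x p q : star_at x p -> star_at x q -> p = q.
Proof.
  intros Sp Sq; apply NNPP; intro N.
  destruct (two_edges_at x) as (e & g & y & z & Je & Jg & Nyz).
  assert (A : forall e y, joins e x y -> joins (f e) p q).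
  { intros h u J; assert (Hx : proj1_sig h x) by (apply (joins_in _ _ _ _ J); auto).
    apply Sp in Hx as Hp; apply Sq in Hx as Hq.
    destruct (in_joins _ _ Hp) as [r K].
    destruct (proj1 (joins_in _ _ _ _ K) Hq); subst; auto; congruence. }
  assert (E : e = g) by (apply Inj; eapply joins_unique; eauto). subst g.
  destruct (joins_ends _ _ _ _ _ Je Jg) as [[? ?]|[? ?]]; subst; congruence.
Qed.

Lemma star_at_injective x y p : star_at x p -> star_at y p -> x = y.
Proof.
  intros Sx Sy; destruct (two_edges_at x) as (e & g & a & b & Je & Jg & N).
  assert (A : forall e a, joins e x a -> y = x \/ y = a).
  { intros h c J; apply (joins_in _ _ _ _ J), Sy, Sx, (joins_in _ _ _ _ J); auto. }
  destruct (A _ _ Je), (A _ _ Jg); congruence.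
Qed.

(** Let [pq] be the image of an edge at [x]. The centres belonging to [p] and [q] are distinct ends
    of that edge, so one of them is [x]. *)
Lemma star_at_total x : exists p, star_at x p.
Proof.
  destruct (two_edges_at x) as (e & _ & y & _ & J & _).
  destruct (joins_exists (f e)) as [p [q K]].
  destruct (pulled_star_is_star p) as [u Su], (pulled_star_is_star q) as [v Sv].
  assert (Hu : proj1_sig e u) by (apply Su, (joins_in _ _ _ _ K); auto).
  assert (Hv : proj1_sig e v) by (apply Sv, (joins_in _ _ _ _ K); auto).
  assert (N : u <> v).
  { intros ->; apply (joins_neq _ _ _ K); eapply star_at_functional; eauto. }
  destruct (proj1 (joins_in _ _ _ _ J) Hu) as [->| ->]; [eauto|].
  destruct (proj1 (joins_in _ _ _ _ J) Hv) as [->| ->]; [eauto|congruence].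
Qed.

End Stars.

(** * The vertex isomorphism *)

Theorem theorem1p3 (G G' : graph) (f : edge G -> edge G') :
  k_connected 3 G ->
  no_isolated G' ->
  ~ is_circuit_graph G' ->
  circuit_surjection f ->
  exists phi : G -> G',
    (forall u1 u2, phi u1 = phi u2 -> u1 = u2) /\
    (forall v' : G', exists u, phi u = v') /\
    (forall (u v : G) (h : adj G u v),
       proj1_sig (f (mk_edge G u v h)) = upair (phi u) (phi v)).
Proof.
  intros H3 Iso NC Hf.
  assert (Inj := circuit_surjection_injective f Hf H3 NC).
  assert (Phi : exists phi : G -> G', forall x, star_at f x (phi x)).
  { exists (fun x => proj1_sig (constructive_indefinite_description _
              (star_at_total f H3 Iso Hf Inj x))).
    intro x; apply proj2_sig. }
  destruct Phi as [phi Hphi]; exists phi.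
  assert (PhiInj : forall u1 u2, phi u1 = phi u2 -> u1 = u2).
  { intros u1 u2 E; apply (star_at_injective f H3 u1 u2 (phi u1)); auto.
    rewrite E; auto. }
  split; [exact PhiInj|split].
  - intro w; destruct (pulled_star_is_star f H3 Iso Hf Inj w) as [u Su].
    exists u; apply (star_at_functional f H3 Inj u); auto.
  - intros u v h; set (e := mk_edge G u v h).
    assert (J : joins e u v) by reflexivity.
    assert (Hu : proj1_sig (f e) (phi u)) by (apply Hphi, (joins_in _ _ _ _ J); auto).
    assert (Hv : proj1_sig (f e) (phi v)) by (apply Hphi, (joins_in _ _ _ _ J); auto).
    destruct (in_joins _ _ Hu) as [w K].
    destruct (proj1 (joins_in _ _ _ _ K) Hv) as [E|E].
    + exfalso; apply (joins_neq _ _ _ J); auto.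
    + rewrite E; exact K.
Qed.
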